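(* Let $G$ be a discrete group and let $f\in \mathrm{B}_{0}(G)\setminus\{0\}$ be such that $f^{n}$ is singular for each $n\in\mathbb{N}$ ($n\ge 1$). Then $f\notin \mathrm{B}_{0}(G)\cap \mathrm{NS}(G)$.
   Context: For a discrete group $G$, $\mathrm{B}(G)$ is the Fourier--Stieltjes algebra (linear span of positive definite functions), a commutative unital Banach algebra under pointwise multiplication, identified with the dual of the full group $C^*$-algebra $C^*(G)$ via $\langle f,x\rangle=\sum_g f(g)x(g)$, $x\in\mathbb{C}[G]$. $W^{\ast}(G):=C^*(G)^{**}=\mathrm{B}(G)^*$ is the universal enveloping von Neumann algebra. $\mathrm{B}_{0}(G):=\mathrm{B}(G)\cap c_{0}(G)$. $\sigma(f)$ is the spectrum of $f$ in $\mathrm{B}(G)$, and $\mathrm{NS}(G)=\{f\in\mathrm{B}(G):\sigma(f)=\overline{f(G)}\}$. For $\varphi\in\mathrm{B}(G)$, the central support $\mathrm{zs}(\varphi)$ is the smallest central projection $z\in W^*(G)$ such that $\varphi$ vanishes on $(1-z)W^*(G)$. Elements $\varphi,\psi\in\mathrm{B}(G)$ are mutually singular ($\varphi\perp\psi$) if $\mathrm{zs}(\varphi)\mathrm{zs}(\psi)=0$. An element $f\in\mathrm{B}(G)$ is called singular if $f\perp\delta_e$, where $e$ is the identity of $G$ and $\delta_e$ the characteristic function of $\{e\}$. *)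

(* Defs.v *)
From HB Require Import structures.
From mathcomp Require Import all_boot all_order all_algebra.
From mathcomp Require Import finmap.
From mathcomp Require Import complex monalg.
From mathcomp Require Import all_classical all_reals topology normedtype.

Set Implicit Arguments.
Unset Strict Implicit.
Unset Printing Implicit Defensive.

Import Order.TTheory GRing.Theory Num.Theory.
Import numFieldNormedType.Exports.

Local Open Scope classical_set_scope.
Local Open Scope ring_scope.

Notation cabs := Normc.normc.

Section GroupAlgebra.
Variables (R : realType) (G : groupType).
Local Notation C := R[i].
Local Notation CG := {malg C[G]}.
Implicit Types (x y : CG) (f : G -> C) (g h : G).

(* [{malg C[G]}] carries only its module structure here: the library's product
   on it is for monoids of monomials, so convolution is defined below. *)
Definition gmul x y : CG :=
  \sum_(g <- msupp x) \sum_(h <- msupp y) << x@_g * y@_h *g (g * h)%g >>.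

Definition gstar x : CG := \sum_(g <- msupp x) << (x@_g)^* *g g^-1%g >>.

Definition pairing f x : C := \sum_(g <- msupp x) f g * x@_g.

Definition Cstar_seminorm (p : CG -> R) : Prop :=
  [/\ forall x, 0 <= p x,
      forall x y, p (x + y) <= p x + p y,
      forall (a : C) x, p (a *: x) = cabs a * p x,
      forall x y, p (gmul x y) <= p x * p y
    & forall x, p (gmul (gstar x) x) = p x ^+ 2].

(* C*(G) is the completion of C[G] for its largest C*-seminorm; the set below
   is bounded above by the l^1-norm of x. *)
Definition Cstar_norm x : R := sup [set p x | p in Cstar_seminorm].

(* A continuous functional on C*(G) is determined by its restriction to C[G],
   i.e. by f with <f, x> = sum_g f(g) x(g). *)
Definition Cstar_bounded f : Prop :=
  exists M : R, forall x, cabs (pairing f x) <= M * Cstar_norm x.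

Lemma cabsE (z : C) : `|z| = (cabs z)%:C%C.
Proof. by case: z => a b; rewrite normc_def. Qed.

Lemma cabs_ge0 (z : C) : 0 <= cabs z.
Proof. by rewrite -ler0c -cabsE. Qed.

Lemma cabsM (a b : C) : cabs (a * b) = cabs a * cabs b.
Proof. exact: Normc.normcM. Qed.

Lemma cabsJ (a : C) : cabs (a^*) = cabs a.
Proof. by apply/complexI; rewrite -!cabsE norm_conjC. Qed.

Lemma cabsD (a b : C) : cabs (a + b) <= cabs a + cabs b.
Proof. by rewrite -lecR rmorphD /= -!cabsE ler_normD. Qed.

Lemma cabs0 : cabs (0 : C) = 0. Proof. exact: Normc.normc0. Qed.

Lemma cabs1 : cabs (1 : C) = 1. Proof. exact: Normc.normc1. Qed.

Lemma cabs_real (r : R) : 0 <= r -> cabs (r%:C%C) = r.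
Proof. by move=> r0; apply/complexI; rewrite -cabsE ger0_norm ?ler0c. Qed.

Lemma pairingE (d : {fset G}) f x : (msupp x `<=` d)%fset ->
  pairing f x = \sum_(g <- d) f g * x@_g.
Proof.
move=> le; rewrite [LHS](big_fset_incl _ le) // => g _ /mcoeff_outdom ->.
by rewrite mulr0.
Qed.

Lemma pairing_is_linear f : linear_for *%R (pairing f).
Proof.
move=> a x y.
pose d := (msupp (a *: x + y) `|` (msupp x `|` msupp y))%fset.
rewrite (@pairingE d) ?fsubsetUl// (@pairingE d _ x); last first.
  by rewrite /d fsetUCA fsubsetUl.
rewrite (@pairingE d _ y); last by rewrite /d fsetUA fsubsetUr.
rewrite mulr_sumr -big_split; apply: eq_bigr => g _ /=.
by rewrite mcoeffD mcoeffZ mulrDr mulrCA.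
Qed.

HB.instance Definition _ f :=
  GRing.isLinear.Build C CG C *%R (pairing f) (pairing_is_linear f).

Lemma pairingU f a g : pairing f << a *g g >> = f g * a.
Proof. by rewrite (pairingE _ msuppU_le) big_seq_fset1 mcoeffUU. Qed.

Lemma pairing_linl (a : C) f f' x :
  pairing (a *: f + f') x = a * pairing f x + pairing f' x.
Proof.
rewrite /pairing mulr_sumr -big_split; apply: eq_bigr => g _ /=.
by rewrite mulrDl mulrA.
Qed.

Lemma pairing_gmul f x y : pairing f (gmul x y) =
  \sum_(g <- msupp x) \sum_(h <- msupp y) f (g * h)%g * (x@_g * y@_h).
Proof.
rewrite raddf_sum; apply: eq_bigr => g _.
by rewrite raddf_sum; apply: eq_bigr => h _; rewrite /= pairingU.
Qed.

Lemma pairing_gstar f x :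
  pairing (fun g => (f g^-1%g)^*) x = (pairing f (gstar x))^*.
Proof.
rewrite [pairing f _]raddf_sum rmorph_sum; apply: eq_bigr => g _ /=.
by rewrite pairingU rmorphM /= conjCK.
Qed.

Lemma gmulUU (a b : C) g h :
  gmul << a *g g >> << b *g h >> = << a * b *g (g * h)%g >>.
Proof.
have U (c : C) k : << c *g k >> = 0 :> CG -> c = 0.
  by move=> /eqP; rewrite monalgU_eq0 => /eqP.
rewrite /gmul !msuppU.
case: eqP => [->|a0]; first by rewrite big_seq_fset0 mul0r monalgU0.
rewrite big_seq_fset1.
case: eqP => [->|b0]; first by rewrite big_seq_fset0 mulr0 monalgU0.
by rewrite big_seq_fset1 !mcoeffUU.
Qed.

Lemma gstarU (a : C) g : gstar << a *g g >> = << a^* *g g^-1%g >>.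
Proof.
rewrite /gstar !msuppU; case: eqP => [->|a0].
  by rewrite big_seq_fset0 rmorph0 monalgU0.
by rewrite big_seq_fset1 !mcoeffUU.
Qed.

Lemma mcoeff_gstar x g : (gstar x)@_g = (x@_(g^-1%g))^*.
Proof.
rewrite /gstar raddf_sum /=.
under eq_bigr do rewrite mcoeffU.
have [gx|gx] := boolP (g^-1%g \in msupp x).
  rewrite (big_fsetD1 _ gx) /= invgK eqxx mulr1n big1_fset ?addr0// => k.
  by rewrite !inE => /andP[/eqP kg _] _; case: eqP => // E; case: kg;
    rewrite -E invgK.
rewrite (mcoeff_outdom gx) rmorph0 big1_fset// => k kx _.
by case: eqP => // E; rewrite -E invgK kx in gx.
Qed.

Lemma gstarK x : gstar (gstar x) = x.
Proof. by apply/malgP => g; rewrite !mcoeff_gstar invgK conjCK. Qed.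

Lemma Cstar_seminorm_delta p g : Cstar_seminorm p -> p << g >> <= 1.
Proof.
case=> p0 _ _ _ pC.
have U (k : G) : p << k >> ^+ 2 = p << 1%g >>.
  by rewrite -pC gstarU gmulUU rmorph1 mulr1 mulVg.
have := U 1%g; set e := p << 1%g >> => ee.
have e1 : e <= 1.
  rewrite leNgt; apply/negP => e1; have : e < e ^+ 2 by rewrite expr2 ltr_pMr// (lt_trans _ e1).
  by rewrite ee ltxx.
by rewrite -(@expr_le1 _ 2)// U.
Qed.

Lemma Cstar_seminorm0 p : Cstar_seminorm p -> p 0 = 0.
Proof. by case=> _ _ pZ _ _; rewrite -(scale0r (0 : CG)) pZ cabs0 mul0r. Qed.

Lemma Cstar_seminorm_sum p (I : Type) (r : seq I) (F : I -> CG) :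
  Cstar_seminorm p -> p (\sum_(i <- r) F i) <= \sum_(i <- r) p (F i).
Proof.
move=> hp; elim: r => [|i r IH]; first by rewrite !big_nil Cstar_seminorm0.
rewrite !big_cons; case: hp => _ pD _ _ _.
by apply: (le_trans (pD _ _)); rewrite lerD2l.
Qed.

Lemma Cstar_seminorm_l1 p x : Cstar_seminorm p ->
  p x <= \sum_(g <- msupp x) cabs x@_g.
Proof.
move=> hp; rewrite {1}(monalgE x).
apply: (le_trans (Cstar_seminorm_sum _ _ hp)); apply: ler_sum => g _.
have -> : << x@_g *g g >> = x@_g *: << g >> :> CG.
  by apply/malgP => k; rewrite mcoeffZ !mcoeffU mulr_natr.
case: (hp) => p0 _ pZ _ _.
by rewrite pZ ler_piMr ?cabs_ge0 ?Cstar_seminorm_delta.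
Qed.

Lemma Cstar_seminorm_gstar p x : Cstar_seminorm p -> p (gstar x) = p x.
Proof.
move=> hp; suff H y : p y <= p (gstar y).
  by apply/eqP; rewrite eq_le H andbT -{2}(gstarK x) H.
case: hp => p0 _ _ pM pC.
have [->|py] := eqVneq (p y) 0; first exact: p0.
have y0 : 0 < p y by rewrite lt_def py p0.
by rewrite -(ler_pM2r y0) -expr2 -pC pM.
Qed.

Lemma Cstar_seminorm_cst0 : Cstar_seminorm (fun=> 0).
Proof. by split=> *; rewrite ?addr0 ?mulr0 ?expr0n. Qed.

Lemma Cstar_norm_ub p x : Cstar_seminorm p -> p x <= Cstar_norm x.
Proof.
move=> hp; apply: ub_le_sup; last by exists p.
by exists (\sum_(g <- msupp x) cabs x@_g) => _ [q hq <-]; exact: Cstar_seminorm_l1.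
Qed.

Lemma Cstar_norm_le x (N : R) :
  (forall p, Cstar_seminorm p -> p x <= N) -> Cstar_norm x <= N.
Proof.
move=> H; apply: ge_sup => [|_ [p hp <-]]; last exact: H.
by exists 0, (fun=> 0) => //; exact: Cstar_seminorm_cst0.
Qed.

Lemma Cstar_norm_ge0 x : 0 <= Cstar_norm x.
Proof. exact: (Cstar_norm_ub x Cstar_seminorm_cst0). Qed.

Lemma Cstar_norm0 : Cstar_norm 0 = 0.
Proof.
apply/eqP; rewrite eq_le Cstar_norm_ge0 andbT.
by apply: Cstar_norm_le => p /Cstar_seminorm0 ->.
Qed.

Lemma Cstar_normZ_le (a : C) x : Cstar_norm (a *: x) <= cabs a * Cstar_norm x.
Proof.
apply: Cstar_norm_le => p hp; case: (hp) => _ _ -> _ _.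
by rewrite ler_wpM2l ?cabs_ge0 ?Cstar_norm_ub.
Qed.

Lemma Cstar_normM_le x y : Cstar_norm (gmul x y) <= Cstar_norm x * Cstar_norm y.
Proof.
apply: Cstar_norm_le => p hp; case: (hp) => p0 _ _ pM _.
by apply: (le_trans (pM _ _)); rewrite ler_pM ?Cstar_norm_ub.
Qed.

Lemma Cstar_norm_gstar x : Cstar_norm (gstar x) <= Cstar_norm x.
Proof.
by apply: Cstar_norm_le => p hp; rewrite Cstar_seminorm_gstar// Cstar_norm_ub.
Qed.

Lemma Cstar_norm_delta g : Cstar_norm << g >> <= 1.
Proof. by apply: Cstar_norm_le => p; exact: Cstar_seminorm_delta. Qed.

End GroupAlgebra.

Section Dual.
Variables (R : realType) (G : groupType).
Local Notation C := R[i].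
Local Notation CG := {malg C[G]}.

Definition Cstar_dual_pred : {pred G -> C} :=
  [pred f | `[< Cstar_bounded f >]].

Lemma Cstar_dual_submod : submod_closed Cstar_dual_pred.
Proof.
split=> [|a f f' /asboolP[M hM] /asboolP[M' hM']]; apply/asboolP.
  exists 0 => x; rewrite mul0r /pairing big1 ?cabs0// => g _.
  by rewrite [_ g]/= mul0r.
exists (cabs a * M + M') => x; rewrite pairing_linl mulrDl.
apply: (le_trans (cabsD _ _)); apply: lerD => //.
by rewrite cabsM -mulrA ler_wpM2l ?cabs_ge0.
Qed.

HB.instance Definition _ :=
  GRing.isSubmodClosed.Build C (G -> C) Cstar_dual_pred Cstar_dual_submod.

(* The Banach space C*(G)^*. *)
Record Cstar_dual := CstarDual {
  dual_fun :> G -> C ; dual_funP : dual_fun \in Cstar_dual_pred }.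

HB.instance Definition _ := [isSub for dual_fun].
HB.instance Definition _ := [Choice of Cstar_dual by <:].
HB.instance Definition _ := [SubChoice_isSubZmodule of Cstar_dual by <:].
HB.instance Definition _ := [SubZmodule_isSubLmodule of Cstar_dual by <:].

Definition dual_norm (f : Cstar_dual) : R :=
  sup [set cabs (pairing f x) | x in [set x : CG | Cstar_norm x <= 1]].

Implicit Types (f : Cstar_dual) (x : CG).

Lemma dual_norm_le f (N : R) : 0 <= N ->
  (forall x, cabs (pairing f x) <= N * Cstar_norm x) -> dual_norm f <= N.
Proof.
move=> N0 H; apply: ge_sup => [|_ [x /= x1 <-]].
  by exists (cabs (pairing f 0)), 0 => //=; rewrite Cstar_norm0.
by apply: (le_trans (H x)); rewrite ler_piMr.
Qed.

Lemma dual_norm_unit f x : Cstar_norm x <= 1 -> cabs (pairing f x) <= dual_norm f.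
Proof.
move=> x1; apply: ub_le_sup; last by exists x.
have /asboolP[M hM] := dual_funP f.
exists `|M| => _ [y /= y1 <-]; apply: (le_trans (hM y)).
have := Cstar_norm_ge0 y => y0.
apply: (@le_trans _ _ (`|M| * Cstar_norm y)); first by rewrite ler_wpM2r ?ler_norm.
by rewrite ler_piMr.
Qed.

Lemma dual_norm_ge0 f : 0 <= dual_norm f.
Proof.
by apply: (le_trans (cabs_ge0 _)); apply: (@dual_norm_unit f 0);
  rewrite Cstar_norm0.
Qed.

Lemma dual_norm_pairing f x :
  cabs (pairing f x) <= dual_norm f * Cstar_norm x.
Proof.
have [x0|x0] := eqVneq (Cstar_norm x) 0.
  have /asboolP[M /(_ x)] := dual_funP f.
  by rewrite x0 !mulr0.
have x_gt0 : 0 < Cstar_norm x by rewrite lt_def x0 Cstar_norm_ge0.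
pose k := (Cstar_norm x)^-1; have k0 : 0 < k by rewrite invr_gt0.
have /(@dual_norm_unit f) : Cstar_norm (k%:C%C *: x) <= 1.
  apply: (le_trans (Cstar_normZ_le _ _)).
  by rewrite cabs_real ?(ltW k0)// mulVf.
by rewrite linearZ cabsM cabs_real ?(ltW k0)// mulrC ler_pdivrMr.
Qed.

Lemma dual_eval_le f g : cabs (f g) <= dual_norm f.
Proof.
by have := dual_norm_unit f (Cstar_norm_delta R g); rewrite pairingU mulr1.
Qed.

(* h |-> f(gh) *)
Definition dual_shift_fun (g : G) f : G -> C := fun h => f (g * h)%g.

Fact pairing_shift f x (y : CG) :
  pairing f (gmul x y) = \sum_(g <- msupp x) x@_g * pairing (dual_shift_fun g f) y.
Proof.
rewrite pairing_gmul; apply: eq_bigr => g _; rewrite mulr_sumr.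
by apply: eq_bigr => h _; rewrite mulrCA.
Qed.

Fact dual_shift_subproof g f : dual_shift_fun g f \in Cstar_dual_pred.
Proof.
apply/asboolP; exists (dual_norm f * Cstar_norm (<< g >> : CG)) => x.
have -> : pairing (dual_shift_fun g f) x = pairing f (gmul << g >> x).
  by rewrite pairing_shift msuppU oner_eq0 big_seq_fset1 mcoeffUU mul1r.
apply: (le_trans (dual_norm_pairing _ _)); rewrite -mulrA.
by rewrite ler_wpM2l ?dual_norm_ge0 ?Cstar_normM_le.
Qed.

Definition dual_shift g f : Cstar_dual := CstarDual (dual_shift_subproof g f).

(* f^*(x) = conj (f(x^* )) *)
Definition dual_star_fun f : G -> C := fun g => (f g^-1%g)^*.

Fact dual_star_bound f x :
  cabs (pairing (dual_star_fun f) x) <= dual_norm f * Cstar_norm x.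
Proof.
rewrite pairing_gstar cabsJ; apply: (le_trans (dual_norm_pairing _ _)).
by rewrite ler_wpM2l ?dual_norm_ge0 ?Cstar_norm_gstar.
Qed.

Fact dual_star_subproof f : dual_star_fun f \in Cstar_dual_pred.
Proof. by apply/asboolP; exists (dual_norm f); exact: dual_star_bound. Qed.

Definition dual_star f : Cstar_dual := CstarDual (dual_star_subproof f).

Lemma dual_star_norm f : dual_norm (dual_star f) <= dual_norm f.
Proof. by apply: dual_norm_le; [exact: dual_norm_ge0|exact: dual_star_bound]. Qed.

End Dual.

Section Bidual.
Variables (R : realType) (G : groupType).
Local Notation C := R[i].
Local Notation CG := {malg C[G]}.
Local Notation D := (Cstar_dual R G).

Definition bidual_bounded (u : D -> C) : Prop :=
  exists M : R, forall f, cabs (u f) <= M * dual_norm f.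

Definition Wstar_pred : {pred D -> C} :=
  [pred u | `[< scalar u /\ bidual_bounded u >]].

Lemma Wstar_submod : submod_closed Wstar_pred.
Proof.
split=> [|a u v /asboolP[ul [M hM]] /asboolP[vl [N hN]]]; apply/asboolP; split.
- by move=> b f f'; rewrite [RHS]addr0 mulr0.
- by exists 0 => f; rewrite mul0r [_ f]/= cabs0.
- move=> b f f'; rewrite [LHS]/(a * u _ + v _) ul vl.
  rewrite -[X in _ = _ * X + _]/(a * u f + v f) -[X in _ = _ + X]/(a * u f' + v f').
  by rewrite !mulrDr mulrCA addrACA.
- exists (cabs a * M + N) => f; rewrite -[X in cabs X]/(a * u f + v f) mulrDl.
  apply: (le_trans (cabsD _ _)); apply: lerD => //.
  by rewrite cabsM -mulrA ler_wpM2l ?cabs_ge0.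
Qed.

HB.instance Definition _ :=
  GRing.isSubmodClosed.Build C (D -> C) Wstar_pred Wstar_submod.

(* W*(G) = C*(G)^** *)
Record Wstar := WStar {
  Wstar_fun :> D -> C ; Wstar_funP : Wstar_fun \in Wstar_pred }.

HB.instance Definition _ := [isSub for Wstar_fun].
HB.instance Definition _ := [Choice of Wstar by <:].
HB.instance Definition _ := [SubChoice_isSubZmodule of Wstar by <:].
HB.instance Definition _ := [SubZmodule_isSubLmodule of Wstar by <:].

Implicit Types (u v w : Wstar) (f : D).

Lemma WstarP u v : (forall f, u f = v f) <-> u = v.
Proof. by split=> [uv|-> //]; apply/val_inj/funext. Qed.

Lemma Wstar_linear u (a : C) f f' : u (a *: f + f') = a * u f + u f'.
Proof. by have /asboolP[ul _] := Wstar_funP u; rewrite ul. Qed.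

HB.instance Definition _ u :=
  GRing.isLinear.Build C D C *%R (Wstar_fun u) (@Wstar_linear u).

Lemma Wstar_bounded u :
  exists2 M : R, 0 <= M & forall f, cabs (u f) <= M * dual_norm f.
Proof.
have /asboolP[_ [M hM]] := Wstar_funP u; exists `|M| => // f.
by apply: (le_trans (hM f)); rewrite ler_wpM2r ?dual_norm_ge0 ?ler_norm.
Qed.

(* v.f : g |-> v(h |-> f(gh)), i.e. <v.f, x> = <v, f.x> with <f.x, y> = <f, xy> *)
Definition arens_fun v f : G -> C := fun g => v (dual_shift g f).

Fact arens_bound v f (M : R) : 0 <= M ->
  (forall f, cabs (v f) <= M * dual_norm f) ->
  forall x : CG, cabs (pairing (arens_fun v f) x) <= M * dual_norm f * Cstar_norm x.
Proof.
move=> M0 hM x; pose s : D := \sum_(g <- msupp x) x@_g *: dual_shift g f.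
have -> : pairing (arens_fun v f) x = v s.
  by rewrite raddf_sum; apply: eq_bigr => g _; rewrite /= linearZ mulrC.
apply: (le_trans (hM s)); rewrite -mulrA ler_wpM2l//.
apply: dual_norm_le => [|y]; first by rewrite mulr_ge0 ?dual_norm_ge0 ?Cstar_norm_ge0.
have -> : pairing s y = pairing f (gmul x y).
  rewrite pairing_shift /s; elim/big_rec2: _ => [|g a b _ IH].
    by rewrite /pairing big1// => g _; rewrite [_ g]/= mul0r.
  by rewrite -[X in pairing X]/(x@_g *: (dual_shift g f : G -> C) + (b : G -> C))
    pairing_linl IH.
apply: (le_trans (dual_norm_pairing _ _)); rewrite -mulrA.
by rewrite ler_wpM2l ?dual_norm_ge0 ?Cstar_normM_le.
Qed.

Fact arens_subproof v f : arens_fun v f \in @Cstar_dual_pred R G.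
Proof.
have [M M0 hM] := Wstar_bounded v.
by apply/asboolP; exists (M * dual_norm f); exact: arens_bound.
Qed.

Definition arens v f : D := CstarDual (arens_subproof v f).

Lemma arens_linear v (a : C) f f' :
  arens v (a *: f + f') = a *: arens v f + arens v f'.
Proof.
apply/val_inj/funext => g.
rewrite -[RHS]/(a * v (dual_shift g f) + v (dual_shift g f')) -Wstar_linear.
by congr (v _); apply/val_inj.
Qed.

Fact Wmul_subproof u v : (fun f => u (arens v f)) \in Wstar_pred.
Proof.
have [M M0 hM] := Wstar_bounded v; have [N N0 hN] := Wstar_bounded u.
apply/asboolP; split=> [a f f'|]; first by rewrite arens_linear Wstar_linear.
exists (N * M) => f; apply: (le_trans (hN _)); rewrite -mulrA ler_wpM2l//.
by apply: dual_norm_le; [rewrite mulr_ge0 ?dual_norm_ge0|exact: arens_bound].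
Qed.

(* The product of the von Neumann algebra W*(G): the Arens product of the
   bidual, extending the one of C[G]. *)
Definition Wmul u v : Wstar := WStar (Wmul_subproof u v).

Fact Wone_subproof : (fun f => f 1%g) \in Wstar_pred.
Proof.
apply/asboolP; split=> [a f f' //|]; exists 1 => f.
by rewrite mul1r dual_eval_le.
Qed.

Definition Wone : Wstar := WStar Wone_subproof.

Fact WmulA : associative Wmul.
Proof.
move=> u v w; apply/WstarP => f; congr (u _); apply/val_inj/funext => g.
congr (v _); apply/val_inj/funext => h; congr (w _); apply/val_inj/funext => k.
by rewrite /= /dual_shift_fun/= mulgA.
Qed.

Fact Wmul1w : left_id Wone Wmul.
Proof.
move=> u; apply/WstarP => f; congr (u _); apply/val_inj/funext => g.
by rewrite /= /dual_shift_fun/= mul1g.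
Qed.

Fact Wmulw1 : right_id Wone Wmul.
Proof.
move=> u; apply/WstarP => f; congr (u _); apply/val_inj/funext => g.
by rewrite /= /arens_fun /= /dual_shift_fun/= mulg1.
Qed.

Fact WmulDl : left_distributive Wmul +%R.
Proof. by move=> u v w; apply/WstarP => f. Qed.

Fact WmulDr : right_distributive Wmul +%R.
Proof.
move=> u v w; apply/WstarP => f.
rewrite -[RHS]/(u (arens v f) + u (arens w f)) -(raddfD u).
by congr (u _); apply/val_inj.
Qed.

HB.instance Definition _ :=
  GRing.Zmodule_isPzRing.Build Wstar WmulA Wmul1w Wmulw1 WmulDl WmulDr.

Fact Wadj_subproof u : (fun f => (u (dual_star f))^*) \in Wstar_pred.
Proof.
have [M M0 hM] := Wstar_bounded u.
apply/asboolP; split=> [a f f'|]; last first.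
  exists M => f; rewrite cabsJ; apply: (le_trans (hM _)).
  by rewrite ler_wpM2l ?dual_star_norm.
have -> : dual_star (a *: f + f') = a^* *: dual_star f + dual_star f'.
  apply/val_inj/funext => g.
  rewrite -[LHS]/((a * f g^-1%g + f' g^-1%g)^*)
    -[RHS]/(a^* * (f g^-1%g)^* + (f' g^-1%g)^*).
  by rewrite rmorphD rmorphM.
by rewrite Wstar_linear rmorphD rmorphM /= conjCK.
Qed.

Definition Wadj u : Wstar := WStar (Wadj_subproof u).

Definition central_projection (z : Wstar) : Prop :=
  [/\ z * z = z, Wadj z = z & forall u, z * u = u * z].

(* phi vanishes on (1 - z) W*(G) *)
Definition vanishes_off (phi : D) (z : Wstar) : Prop :=
  forall u : Wstar, ((1 - z) * u) phi = 0.

End Bidual.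

Section FourierStieltjes.
Variables (R : realType) (G : groupType).
Local Notation C := R[i].
Implicit Types (f phi psi : G -> C).

Definition positive_definite phi : Prop :=
  forall (n : nat) (c : 'I_n -> C) (g : 'I_n -> G),
    0 <= \sum_(i < n) \sum_(j < n) (c i)^* * c j * phi ((g i)^-1 * g j)%g.

Definition BG : set (G -> C) :=
  [set f | exists (n : nat) (c : 'I_n -> C) (phi : 'I_n -> G -> C),
     (forall i, positive_definite (phi i)) /\ f = \sum_(i < n) c i *: phi i].

Definition c0 : set (G -> C) :=
  [set f | forall e : R, 0 < e -> finite_set [set g | e <= cabs (f g)]].

Definition B0 : set (G -> C) := BG `&` c0.

Definition BG_invertible f : Prop := exists2 h : G -> C, BG h & f * h = 1.

(* The type [C^o] only selects the topology of C. *)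
Definition spectrum f : set C^o :=
  [set l : C^o | ~ BG_invertible (cst (l : C) - f)].

Definition NS : set (G -> C) :=
  [set f | BG f /\ spectrum f = closure (range f : set C^o)].

(* z is the smallest central projection such that phi, seen in C*(G)^*,
   vanishes on (1 - z) W*(G); z <= z' for projections means z z' = z. *)
Definition central_support phi (z : Wstar R G) : Prop :=
  exists2 phi' : Cstar_dual R G, phi = phi' &
    [/\ central_projection z, vanishes_off phi' z
      & forall z', central_projection z' -> vanishes_off phi' z' -> z * z' = z].

Definition mutually_singular phi psi : Prop :=
  exists z w : Wstar R G,
    [/\ central_support phi z, central_support psi w & z * w = 0].

Definition delta_e : G -> C := fun g => (g == 1%g)%:R.

Definition singular f : Prop := mutually_singular f delta_e.

End FourierStieltjes.

Arguments BG {R G}.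
Arguments c0 {R G}.
Arguments B0 {R G}.
Arguments NS {R G}.

(* Main.v *)
(** Pick [k] with [f k <> 0] and a radius [rho < |f k|] at positive
    distance from all the [|f g|]; put [a = f / rho].  Naturality of the
    spectrum makes [1 - z a] invertible in B(G) for all [|z| = 1].  Averaging
    these inverses over the 2^n-th roots of unity gives [(1 - a^(2^n))^-1],
    which therefore converges in the norm of B(G); the limit is the indicator of
    [{|a| < 1}].  Hence, up to a function supported in the finite set
    [{|a| > 1}], [a^(2^n)] is bounded in B(G), uniformly in [n].

    Let [w] be the central support of [delta_e], and [L = w k] in W*(G).  Then
    [L] kills the singular elements [f^n], and [L delta_g] is 1 for [g = k] and
    0 otherwise.  So the part of [a^(2^n)] with finite support contributes
    [a(k)^(2^n)] to [L (a^(2^n)) = 0], up to a bounded error.  As [|a k| > 1],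
    this is absurd for large [n]. *)

Require Import Defs.
From mathcomp Require Import all_boot all_order all_algebra complex.
From mathcomp Require Import finmap monalg.
From mathcomp Require Import all_classical all_reals ring lra.
From mathcomp Require Import topology normedtype sequences realfun.

Set Implicit Arguments.
Unset Strict Implicit.
Unset Printing Implicit Defensive.

Import Order.TTheory GRing.Theory Num.Theory.
Import numFieldNormedType.Exports.
Local Open Scope classical_set_scope.
Local Open Scope ring_scope.

(** * The GNS seminorm of a positive definite function *)

Section PositiveDefinite.
Variables (R : realType) (G : groupType).
Local Notation C := R[i].
Implicit Types (phi : G -> C).

(** Turns a linear consequence of a known equation into an identity between differences, which
    [ring] can check. *)
Lemma eq_from_subr (V : zmodType) (a b c d : V) : a = b -> d - c = a - b -> c = d.
Proof. by move=> ->; rewrite subrr => /subr0_eq. Qed.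

Lemma posdef2 phi (c d : C) (g h : G) : positive_definite phi ->
  0 <= c^* * c * phi 1%g + c^* * d * phi (g^-1 * h)%g
     + (d^* * c * phi (h^-1 * g)%g + d^* * d * phi 1%g).
Proof.
move=> /(_ 2%N (fun i => if i == ord0 then c else d)
              (fun i => if i == ord0 then g else h)).
by rewrite !big_ord_recl !big_ord0 /= !addr0 !mulVg.
Qed.

Lemma posdef_ge0 phi : positive_definite phi -> 0 <= phi 1%g.
Proof.
by move=> /(@posdef2 _ 1 0 1%g 1%g); rewrite rmorph1 rmorph0 !(mul0r, mulr0, addr0) !mul1r.
Qed.

(** The two-point form is real at every unimodular coefficient [c]; [c = 1] and [c = 'i] give two
    linear equations whose combination is the claim. *)
Lemma posdef_conj phi g : positive_definite phi -> phi g^-1%g = (phi g)^*.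
Proof.
move=> hp; have p0 := ger0_real (posdef_ge0 hp).
have H c : c^* * c = 1 -> c * phi g + c^* * phi g^-1%g \is Num.real.
  move=> c1; have := ger0_real (@posdef2 phi 1 c 1%g g hp).
  rewrite rmorph1 c1 !mul1r !mulr1 invg1 mul1g.
  rewrite mulg1 => X.
  have -> : c * phi g + c^* * phi g^-1%g = phi 1%g + c * phi g
    + (c^* * phi g^-1%g + phi 1%g) - (phi 1%g + phi 1%g) by ring.
  by rewrite rpredB// rpredD.
have := H 1; rewrite rmorph1 !mul1r => /(_ erefl)/CrealP E1.
have := H 'i; rewrite conjCi mulNr -expr2 sqrCi opprK => /(_ erefl)/CrealP E2.
move: E1 E2; rewrite !rmorphD !rmorphM rmorphN /= conjCi => E1 E2.
have E3 : 'i * ((phi g)^* - (phi g^-1%g)^*) = 'i * (phi g^-1%g - phi g).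
  by apply: (eq_from_subr E2); ring.
move/(mulfI (neq0Ci _)): E3 => E3.
apply: (@mulIf _ (2%:R)); first by rewrite pnatr_eq0.
by apply: (eq_from_subr (congr2 +%R E1 E3)); ring.
Qed.

(** Positivity of the two-point form at the phase [c] with [c * phi g = - |phi g|]. *)
Lemma posdef_le phi g : positive_definite phi -> `|phi g| <= phi 1%g.
Proof.
move=> hp; have [->|pg] := eqVneq (phi g) 0; first by rewrite normr0 posdef_ge0.
pose c := - (phi g)^* / `|phi g|.
have n0 : `|phi g| != 0 by rewrite normr_eq0.
have cc : c^* * c = 1.
  rewrite mulrC -normCK /c normrM normrN norm_conjC normfV normr_id divff//.
  by rewrite expr1n.
have cg : c * phi g = - `|phi g|.
  by rewrite /c mulrAC mulNr mulrC [_^* * _]mulrC -normCK mulrN expr2 mulrA mulVf ?mul1r.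
have := @posdef2 phi 1 c 1%g g hp.
rewrite rmorph1 cc !mul1r !mulr1 invg1 mul1g mulg1 posdef_conj// -rmorphM cg.
rewrite /= conj_Creal ?rpredN ?normr_real//.
have -> : phi 1%g - `|phi g| + (- `|phi g| + phi 1%g) = (phi 1%g - `|phi g|) *+ 2.
  by rewrite mulr2n; ring.
by rewrite -mulr_natl pmulr_rge0 ?ltr0n// subr_ge0.
Qed.

End PositiveDefinite.

(** * The involutive convolution algebra C[G] *)

Section Convolution.
Variables (R : realType) (G : groupType).
Local Notation C := R[i].
Local Notation CG := {malg C[G]}.
Implicit Types (x y z : CG) (f : G -> C).

(** Indicator functions read off the coefficients. Convolution identities can thus be proved by
    pairing with an arbitrary [f], with no bookkeeping of supports. *)
Lemma pairing_sep x y : (forall f, pairing f x = pairing f y) -> x = y.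
Proof.
move=> H; apply/malgP => k; have := H (fun g => (g == k)%:R).
suff E z : pairing (fun g => (g == k)%:R) z = z@_k by rewrite !E.
rewrite /pairing.
have [kz|kz] := boolP (k \in msupp z).
  rewrite (big_fsetD1 _ kz)/= eqxx big1_fset ?addr0 ?mul1r// => g.
  by rewrite !inE => /andP[/negPf-> _] _; rewrite mul0r.
rewrite (mcoeff_outdom kz) big1_fset// => g gz _.
by case: eqP => [E|_]; [rewrite -E gz in kz|rewrite mul0r].
Qed.

Lemma pairing_gmulE f x y : pairing f (gmul x y) =
  pairing (fun g => pairing (fun h => f (g * h)%g) y) x.
Proof.
rewrite pairing_gmul; apply: eq_bigr => g _; rewrite mulr_suml.
by apply: eq_bigr => h _; rewrite [x@__ * _]mulrC mulrA.
Qed.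

Lemma pairing_gstarE f x :
  pairing f (gstar x) = (pairing (fun g => (f g^-1%g)^*) x)^*.
Proof. by rewrite pairing_gstar conjCK. Qed.

Lemma pairing_exchange (F : G -> G -> C) x y :
  pairing (fun g => pairing (F g) y) x = pairing (fun h => pairing (F^~ h) x) y.
Proof.
rewrite /pairing; under eq_bigr do rewrite mulr_suml.
rewrite exchange_big; apply: eq_bigr => h _; rewrite mulr_suml.
by apply: eq_bigr => g _; rewrite mulrAC.
Qed.

Lemma eq_pairing f f' x : f =1 f' -> pairing f x = pairing f' x.
Proof. by move=> /funext ->. Qed.

Lemma gmulA : associative (@gmul R G).
Proof.
move=> x y z; apply: pairing_sep => f; rewrite !pairing_gmulE.
apply: eq_pairing => g; rewrite pairing_gmulE; apply: eq_pairing => h.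
by apply: eq_pairing => k; rewrite mulgA.
Qed.

Lemma gstar_gmul x y : gstar (gmul x y) = gmul (gstar y) (gstar x).
Proof.
apply: pairing_sep => f; rewrite pairing_gstarE !pairing_gmulE pairing_gstarE.
congr (_^*); rewrite pairing_exchange; apply: eq_pairing => h.
rewrite pairing_gstarE conjCK; apply: eq_pairing => g.
by rewrite invgM.
Qed.

Lemma gmul1x x : gmul << 1%g >> x = x.
Proof.
apply: pairing_sep => f; rewrite pairing_gmulE pairingU mulr1.
by apply: eq_pairing => g; rewrite mul1g.
Qed.

Lemma gmulx1 x : gmul x << 1%g >> = x.
Proof.
apply: pairing_sep => f; rewrite pairing_gmulE.
by apply: eq_pairing => g; rewrite pairingU mulg1 mulr1.
Qed.

Lemma gmul_linr x (a : C) y z : gmul x (a *: y + z) = a *: gmul x y + gmul x z.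
Proof.
apply: pairing_sep => f; rewrite linearP/= !pairing_gmulE -pairing_linl.
by apply: eq_pairing => g; rewrite linearP.
Qed.

Lemma gmul_linl (a : C) x y z : gmul (a *: x + y) z = a *: gmul x z + gmul y z.
Proof.
by apply: pairing_sep => f; rewrite linearP/= !pairing_gmulE linearP.
Qed.

Lemma gmulx0 x : gmul x 0 = 0.
Proof.
apply: pairing_sep => f; rewrite pairing_gmulE raddf0.
by rewrite /pairing big1// => g _; rewrite big1 ?mul0r// => h _; rewrite mcoeff0 mulr0.
Qed.

Lemma gmul0x x : gmul 0 x = 0.
Proof. by apply: pairing_sep => f; rewrite pairing_gmulE !raddf0. Qed.

Lemma gmulZl (a : C) x y : gmul (a *: x) y = a *: gmul x y.
Proof. by rewrite -[a *: x]addr0 gmul_linl gmul0x addr0. Qed.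

End Convolution.

Section GNS.
Variables (R : realType) (G : groupType) (phi : G -> R[i]).
Hypothesis phi_pd : positive_definite phi.
Local Notation C := R[i].
Local Notation CG := {malg C[G]}.
Implicit Types (x y z : CG).

(** The GNS sesquilinear form, conjugate-linear in the first argument and possibly degenerate. *)
Definition gns_form x y : C := pairing phi (gmul (gstar x) y).

Lemma gns_formE x y : gns_form x y =
  \sum_(g <- msupp x) \sum_(h <- msupp y) (x@_g)^* * y@_h * phi (g^-1 * h)%g.
Proof.
rewrite /gns_form pairing_gmulE pairing_gstarE rmorph_sum; apply: eq_bigr => g _.
rewrite rmorphM /= conjCK mulr_suml; apply: eq_bigr => h _.
by rewrite -mulrA mulrC [y@_h * _]mulrC.
Qed.

Lemma gns_form_ge0 x : 0 <= gns_form x x.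
Proof.
rewrite gns_formE big_tnth; under eq_bigr do rewrite big_tnth.
exact: (phi_pd (fun i => x@_(tnth (in_tuple (msupp x)) i))
  (tnth (in_tuple (msupp x)))).
Qed.

Lemma gns_form_conj x y : (gns_form x y)^* = gns_form y x.
Proof.
rewrite /gns_form -{2}(gstarK x) -gstar_gmul pairing_gstarE; congr (_^*).
by apply: eq_pairing => g; rewrite posdef_conj ?conjCK.
Qed.

Lemma gns_form_linr x (a : C) y z :
  gns_form x (a *: y + z) = a * gns_form x y + gns_form x z.
Proof. by rewrite /gns_form gmul_linr linearP. Qed.

Lemma gns_form_linl (a : C) x y z :
  gns_form (a *: x + y) z = a^* * gns_form x z + gns_form y z.
Proof. by rewrite -gns_form_conj gns_form_linr rmorphD rmorphM /= !gns_form_conj. Qed.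

Lemma gns_form_gmul x y z : gns_form (gmul x y) z = gns_form y (gmul (gstar x) z).
Proof. by rewrite /gns_form gstar_gmul gmulA. Qed.

Lemma gns_form_sqD (a : C) x y : gns_form (a *: x + y) (a *: x + y) =
  `|a| ^+ 2 * gns_form x x + (a * gns_form y x + (a * gns_form y x)^*) + gns_form y y.
Proof.
have -> : (a * gns_form y x)^* = a^* * gns_form x y.
  by rewrite rmorphM /= gns_form_conj.
rewrite gns_form_linr !gns_form_linl normCK.
move: (gns_form x x) (gns_form x y) (gns_form y x) (gns_form y y) (a^*) => p q r t b.
by ring.
Qed.

Lemma gns_CS x y : `|gns_form x y| ^+ 2 <= gns_form x x * gns_form y y.
Proof.
set c := gns_form x y; set A := gns_form x x; set B := gns_form y y.
have A0 : 0 <= A := gns_form_ge0 x; have B0 : 0 <= B := gns_form_ge0 y.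
(* Positivity at [- t c x + y] for real [t]: a quadratic polynomial in [t]. *)
have key (t : C) : t \is Num.real ->
    0 <= t ^+ 2 * `|c| ^+ 2 * A - t * `|c| ^+ 2 *+ 2 + B.
  move=> tr; have := gns_form_ge0 ((- t * c) *: x + y).
  rewrite gns_form_sqD -(gns_form_conj x y) -/A -/B -/c.
  have -> : - t * c * c^* = - (t * `|c| ^+ 2) by rewrite normCK; ring.
  rewrite (conj_Creal (_ : - (t * `|c| ^+ 2) \is Num.real)); last first.
    by rewrite rpredN rpredM// rpredX// normr_real.
  rewrite normrM normrN exprMn real_normK// mulr2n.
  by rewrite opprD.
have [A00|An0] := eqVneq A 0; last first.
  have A1 : 0 < A by rewrite lt_def An0.
  have := key A^-1; rewrite rpredV ger0_real// => /(_ isT).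
  rewrite -(pmulr_rge0 _ A1).
  have -> : A * (A^-1 ^+ 2 * `|c| ^+ 2 * A - A^-1 * `|c| ^+ 2 *+ 2 + B) = A * B - `|c| ^+ 2.
    by rewrite mulr2n; field.
  by rewrite subr_ge0.
rewrite A00 mul0r; have [->|cn0] := eqVneq c 0; first by rewrite normr0 expr0n.
have c1 : 0 < `|c| ^+ 2 by rewrite exprn_gt0// normr_gt0.
(* When [A = 0] the polynomial is affine in [t]; at this [t] its value is [- (B + 2) < 0], which
   excludes [c != 0]. *)
have := key ((B + 1) / `|c| ^+ 2).
rewrite rpredM ?rpredV ?rpredD ?rpred1 ?ger0_real ?(ltW c1)// => /(_ isT).
rewrite A00 mulr0 add0r mulfVK ?gt_eqF// mulr2n.
have -> : - (B + 1 + (B + 1)) + B = - (B + (1 + 1)) by ring.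
have B2 : 0 < B + (1 + 1) by rewrite ltr_wpDl// addr_gt0 ?ltr01.
by rewrite oppr_ge0 (lt_geF B2).
Qed.

Definition gns_norm x : R := Num.sqrt (complex.Re (gns_form x x)).

Lemma gns_norm_ge0 x : 0 <= gns_norm x. Proof. exact: sqrtr_ge0. Qed.

Lemma gns_norm_sq x : ((gns_norm x) ^+ 2)%:C%C = gns_form x x.
Proof.
have := gns_form_ge0 x; rewrite /gns_norm lecE /= => /andP[/eqP Im0 Re0].
by rewrite sqr_sqrtr//; case: (gns_form x x) Im0 => a b /= ->.
Qed.

Lemma gns_norm_CS x y : cabs (gns_form x y) <= gns_norm x * gns_norm y.
Proof.
have := gns_CS x y; rewrite cabsE -!gns_norm_sq -rmorphXn -rmorphM lecR -exprMn.
by rewrite ler_pXn2r// nnegrE ?cabs_ge0// mulr_ge0 ?gns_norm_ge0.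
Qed.

Lemma gns_normZ (a : C) x : gns_norm (a *: x) = cabs a * gns_norm x.
Proof.
apply/eqP; rewrite -(@eqrXn2 _ 2)// ?mulr_ge0 ?cabs_ge0 ?gns_norm_ge0//; apply/eqP.
apply/complexI; rewrite gns_norm_sq exprMn rmorphM /= gns_norm_sq rmorphXn /= -cabsE.
have g0 z : gns_form z 0 = 0 by rewrite /gns_form gmulx0 raddf0.
by have := gns_form_sqD a x 0; rewrite -(gns_form_conj x 0) !g0 conjC0 mulr0 conjC0 !addr0.
Qed.

Lemma gns_normD x y : gns_norm (x + y) <= gns_norm x + gns_norm y.
Proof.
rewrite -(@ler_pXn2r _ 2)// ?nnegrE ?addr_ge0 ?gns_norm_ge0//.
have : gns_form (x + y) (x + y) =
    gns_form x x + (gns_form y x + (gns_form y x)^*) + gns_form y y.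
  rewrite -{1 2}(scale1r x) gns_form_linr !gns_form_linl conjC1.
  rewrite (gns_form_conj y x).
  by move: (gns_form x x) (gns_form x y) (gns_form y x) (gns_form y y) => p q r t; ring.
rewrite -(gns_norm_sq x) -(gns_norm_sq y) -(gns_norm_sq (x + y)).
have := gns_norm_CS y x; case: (gns_form y x) => u v uv /(congr1 (@complex.Re R)) /= ->.
have : u <= gns_norm y * gns_norm x.
  apply: (le_trans _ uv); apply: (le_trans (ler_norm u)).
  by rewrite -sqrtr_sqr /= ler_wsqrtr// lerDl sqr_ge0.
by move=> u1; rewrite sqrrD lerD2r lerD2l mulr2n mulrC lerD.
Qed.

Lemma gns_norm0 : gns_norm 0 = 0.
Proof. by rewrite -(scale0r (0 : CG)) gns_normZ cabs0 mul0r. Qed.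

Lemma gns_norm_deltal g y : gns_norm (gmul << g >> y) = gns_norm y.
Proof.
congr (Num.sqrt (complex.Re _)).
by rewrite gns_form_gmul gmulA gstarU gmulUU rmorph1 mulr1 mulVg gmul1x.
Qed.

Lemma gns_norm_l1 x y :
  gns_norm (gmul x y) <= (\sum_(g <- msupp x) cabs x@_g) * gns_norm y.
Proof.
rewrite {1}(monalgE x) mulr_suml; elim/big_rec2: _ => [|g M z _ IH].
  by rewrite gmul0x gns_norm0.
have -> : << x@_g *g g >> = x@_g *: << g >> :> CG.
  by apply/malgP => k; rewrite mcoeffZ !mcoeffU mulr_natr.
rewrite gmul_linl; apply: (le_trans (gns_normD _ _)).
by rewrite gns_normZ gns_norm_deltal lerD.
Qed.

(* [gns_op x] is the operator norm of left convolution by [x] on the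
   (unseparated) GNS space of phi. *)
Definition gns_bounds x : set R :=
  [set M | 0 <= M /\ forall y, gns_norm (gmul x y) <= M * gns_norm y]%classic.

Definition gns_op x : R := inf (gns_bounds x).

Lemma gns_bounds_has_inf x : has_inf (gns_bounds x).
Proof.
split; last by exists 0 => M [].
exists (\sum_(g <- msupp x) cabs x@_g); split=> [|y]; last exact: gns_norm_l1.
by rewrite sumr_ge0// => g _; exact: cabs_ge0.
Qed.

Lemma gns_op_le x (M : R) : 0 <= M ->
  (forall y, gns_norm (gmul x y) <= M * gns_norm y) -> gns_op x <= M.
Proof. by move=> M0 H; apply: ge_inf; [exists 0 => N []|split]. Qed.

Lemma gns_op_ge0 x : 0 <= gns_op x.
Proof. by apply: lb_le_inf => [|M []//]; case: (gns_bounds_has_inf x). Qed.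

Lemma gns_opP x y : gns_norm (gmul x y) <= gns_op x * gns_norm y.
Proof.
(* For a null vector no division is possible, and the l^1 bound shows that its image is null too. *)
have [y0|y0] := eqVneq (gns_norm y) 0.
  by have := gns_norm_l1 x y; rewrite y0 !mulr0.
have yp : 0 < gns_norm y by rewrite lt_def y0 gns_norm_ge0.
rewrite -ler_pdivrMr//; apply: lb_le_inf => [|M [_ H]].
  by case: (gns_bounds_has_inf x).
by rewrite ler_pdivrMr.
Qed.

Lemma gns_opZ_le (a : C) x : gns_op (a *: x) <= cabs a * gns_op x.
Proof.
apply: gns_op_le => [|y]; first by rewrite mulr_ge0 ?cabs_ge0 ?gns_op_ge0.
by rewrite gmulZl gns_normZ -mulrA ler_wpM2l ?cabs_ge0 ?gns_opP.
Qed.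

(** With [z = gmul (gstar x) y], Cauchy-Schwarz for [<z, z> = <y, x z>] gives
    [|z|^2 <= |y| * gns_op x * |z|]. *)
Lemma gns_op_gstar_le x : gns_op (gstar x) <= gns_op x.
Proof.
apply: gns_op_le => [|y]; first exact: gns_op_ge0.
set z := gmul (gstar x) y.
have [z0|z0] := eqVneq (gns_norm z) 0.
  by rewrite z0 mulr_ge0 ?gns_op_ge0 ?gns_norm_ge0.
have zp : 0 < gns_norm z by rewrite lt_def z0 gns_norm_ge0.
rewrite -(ler_pM2r zp) -expr2 -(cabs_real (sqr_ge0 _)) gns_norm_sq {1}/z.
rewrite gns_form_gmul gstarK; apply: (le_trans (gns_norm_CS _ _)).
by rewrite mulrC mulrAC ler_wpM2r ?gns_norm_ge0 ?gns_opP.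
Qed.

(** Places the norm of the GNS representation among the seminorms whose supremum is [Cstar_norm]. *)
Lemma gns_op_Cstar : Cstar_seminorm gns_op.
Proof.
split; first exact: gns_op_ge0.
- move=> x y; apply: gns_op_le => [|z]; first by rewrite addr_ge0 ?gns_op_ge0.
  have -> : gmul (x + y) z = gmul x z + gmul y z.
    by rewrite -[x]scale1r gmul_linl !scale1r.
  by rewrite mulrDl; apply: (le_trans (gns_normD _ _)); rewrite lerD ?gns_opP.
- move=> a x; apply/eqP; rewrite eq_le gns_opZ_le/=.
  have [->|a0] := eqVneq a 0; first by rewrite cabs0 mul0r gns_op_ge0.
  have ap : 0 < cabs a by rewrite -ltcR -cabsE normr_gt0.
  have := gns_opZ_le a^-1 (a *: x); rewrite scalerA mulVf// scale1r.
  by rewrite Normc.normcV mulrC ler_pdivlMr// mulrC.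
- move=> x y; apply: gns_op_le => [|z]; first by rewrite mulr_ge0 ?gns_op_ge0.
  rewrite -gmulA; apply: (le_trans (gns_opP _ _)).
  by rewrite -mulrA ler_wpM2l ?gns_op_ge0 ?gns_opP.
- move=> x; apply/eqP; rewrite eq_le; apply/andP; split.
    apply: gns_op_le => [|z]; first by rewrite exprn_ge0 ?gns_op_ge0.
    rewrite -gmulA; apply: (le_trans (gns_opP _ _)).
    rewrite expr2 -mulrA ler_pM ?gns_op_ge0 ?gns_norm_ge0 ?gns_op_gstar_le//.
    exact: gns_opP.
  (* Since [<x y, x y> = <y, gstar x x y>], Cauchy-Schwarz makes the square root of
     [gns_op (gmul (gstar x) x)] a bound for convolution by [x]. *)
  rewrite -[leRHS]sqr_sqrtr ?gns_op_ge0// ler_pXn2r ?nnegrE ?gns_op_ge0 ?sqrtr_ge0//.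
  apply: gns_op_le => [|y]; first exact: sqrtr_ge0.
  rewrite -(@ler_pXn2r _ 2)// ?nnegrE ?mulr_ge0 ?gns_norm_ge0 ?sqrtr_ge0//.
  rewrite exprMn (sqr_sqrtr (gns_op_ge0 _)) -(cabs_real (sqr_ge0 (gns_norm (gmul x y)))).
  rewrite gns_norm_sq gns_form_gmul gmulA; apply: (le_trans (gns_norm_CS _ _)).
  by rewrite mulrC expr2 mulrA ler_wpM2r ?gns_norm_ge0 ?gns_opP.
Qed.

(** [phi] is the vector functional [<delta_e, x delta_e>] of its GNS representation, and
    [|delta_e|^2 = phi 1]. *)
Lemma posdef_pairing_le x : cabs (pairing phi x) <= complex.Re (phi 1%g) * Cstar_norm x.
Proof.
have e : gns_norm << 1%g >> ^+ 2 = complex.Re (phi 1%g).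
  by apply/complexI; rewrite gns_norm_sq /gns_form gstarU gmulUU rmorph1 mulr1 mulVg
    pairingU mulr1 RRe_real// ger0_real// posdef_ge0.
have -> : pairing phi x = gns_form << 1%g >> (gmul x << 1%g >>).
  by rewrite /gns_form gmulx1 gstarU rmorph1 invg1 gmul1x.
apply: (le_trans (gns_norm_CS _ _)).
rewrite -e expr2 -mulrA ler_wpM2l ?gns_norm_ge0// mulrC.
apply: (le_trans (gns_opP _ _)); rewrite ler_wpM2r ?gns_norm_ge0//.
exact: Cstar_norm_ub gns_op_Cstar.
Qed.

End GNS.

(** * The cone of positive definite functions *)

Section SchurProduct.
Variable C : numClosedFieldType.
Local Open Scope sesquilinear_scope.

(** The spectral theorem: [P] is unitary and diagonalizes [A], and the eigenvalue [d k] is the value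
    of the form at the conjugate of row [k] of [P]. *)
Lemma psd_gram n (A : 'M[C]_n) : (forall i j, A j i = (A i j)^*) ->
  (forall c : 'I_n -> C, 0 <= \sum_i \sum_j (c i)^* * c j * A i j) ->
  exists (d : 'I_n -> C) (P : 'M[C]_n), (forall k, 0 <= d k) /\
    forall i j, A i j = \sum_k d k * ((P k i)^* * P k j).
Proof.
move=> Ah Apos.
have /hermitian_normalmx/orthomx_spectralP Ae : A \is hermsymmx.
  apply/is_hermitianmxP; rewrite expr0 scale1r; apply/matrixP => i j.
  by rewrite !mxE Ah.
set P := spectralmx A in Ae; set d := spectral_diag A in Ae.
have Pu : P \is unitarymx by exact: spectral_unitarymx.
exists (fun k => d 0 k), P; split=> [k|i j]; last first.
  rewrite {1}Ae invmx_unitary// mxE; apply: eq_bigr => k _.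
  by rewrite mul_mx_diag !mxE; ring.
have De : diag_mx d = P *m A *m P^t*.
  have /unitarymxP PP := Pu.
  by rewrite {1}Ae invmx_unitary// !mulmxA PP mul1mx -mulmxA PP mulmx1.
have := Apos (fun i => (P k i)^*); have /matrixP/(_ k k) := De.
rewrite !mxE eqxx mulr1n => ->; congr (0 <= _).
rewrite exchange_big; apply: eq_bigr => j _; rewrite !mxE mulr_suml.
by apply: eq_bigr => i _; rewrite conjCK mulrAC.
Qed.

(** Expanding [A] by [psd_gram] turns the form of the entrywise product into a combination, with
    weights [d k >= 0], of values of the form of [B] at the vectors [P k i * c i]. *)
Lemma schur_product n (A B : 'M[C]_n) :
  (forall i j, A j i = (A i j)^*) ->
  (forall c : 'I_n -> C, 0 <= \sum_i \sum_j (c i)^* * c j * A i j) ->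
  (forall c : 'I_n -> C, 0 <= \sum_i \sum_j (c i)^* * c j * B i j) ->
  forall c : 'I_n -> C, 0 <= \sum_i \sum_j (c i)^* * c j * (A i j * B i j).
Proof.
move=> Ah Apos Bpos c; have [d [P [d0 AE]]] := psd_gram Ah Apos.
have -> : \sum_i \sum_j (c i)^* * c j * (A i j * B i j) =
    \sum_k d k * \sum_i \sum_j (P k i * c i)^* * (P k j * c j) * B i j.
  under [RHS]eq_bigr do rewrite mulr_sumr; rewrite [RHS]exchange_big.
  apply: eq_bigr => i _; under [RHS]eq_bigr do rewrite mulr_sumr.
  rewrite [RHS]exchange_big; apply: eq_bigr => j _.
  rewrite AE mulr_suml mulr_sumr; apply: eq_bigr => k _.
  by rewrite rmorphM /=; ring.
by apply: sumr_ge0 => k _; rewrite mulr_ge0// Bpos.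
Qed.

End SchurProduct.

Section PositiveDefiniteCone.
Variables (R : realType) (G : groupType).
Local Notation C := R[i].
Implicit Types (phi psi : G -> C).

Lemma posdef0 : positive_definite (0 : G -> C).
Proof.
by move=> n c g; rewrite big1// => i _; rewrite big1// => j _; rewrite mulr0.
Qed.

Lemma posdef1 : positive_definite (1 : G -> C).
Proof.
move=> n c g; have -> : \sum_i \sum_j (c i)^* * c j * (1 : G -> C) ((g i)^-1 * g j)%g
    = (\sum_i c i) * (\sum_i c i)^*.
  rewrite mulrC rmorph_sum mulr_suml; apply: eq_bigr => i _; rewrite mulr_sumr.
  by apply: eq_bigr => j _; rewrite mulr1.
by rewrite mul_conjC_ge0.
Qed.

Lemma posdefD phi psi :
  positive_definite phi -> positive_definite psi -> positive_definite (phi + psi).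
Proof.
move=> hp hq n c g; have := addr_ge0 (hp n c g) (hq n c g).
congr (0 <= _); rewrite -big_split; apply: eq_bigr => i _; rewrite -big_split.
by apply: eq_bigr => j _; rewrite /= -mulrDr.
Qed.

Lemma posdef_sum (I : Type) (r : seq I) (F : I -> G -> C) :
  (forall i, positive_definite (F i)) -> positive_definite (\sum_(i <- r) F i).
Proof.
by move=> h; elim/big_ind: _ => // [|phi psi]; [exact: posdef0|exact: posdefD].
Qed.

Lemma posdefZ (a : C) phi : 0 <= a -> positive_definite phi -> positive_definite (a *: phi).
Proof.
move=> a0 hp n c g; have := mulr_ge0 a0 (hp n c g).
congr (0 <= _); rewrite mulr_sumr; apply: eq_bigr => i _; rewrite mulr_sumr.
by apply: eq_bigr => j _; rewrite mulrCA.
Qed.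

Lemma posdefM phi psi :
  positive_definite phi -> positive_definite psi -> positive_definite (phi * psi).
Proof.
move=> hp hq n c g.
have := @schur_product _ n (\matrix_(i, j) phi ((g i)^-1 * g j)%g)
  (\matrix_(i, j) psi ((g i)^-1 * g j)%g) _ _ _ c.
have E F d : \sum_i \sum_j (d i)^* * d j * (\matrix_(i, j) F ((g i)^-1 * g j)%g : 'M[C]_n) i j
  = \sum_i \sum_j (d i)^* * d j * F ((g i)^-1 * g j)%g.
  by apply: eq_bigr => i _; apply: eq_bigr => j _; rewrite mxE.
under eq_bigr do under eq_bigr do rewrite !mxE.
apply=> [i j|d|d]; rewrite ?E//.
by rewrite !mxE -posdef_conj// invgM invgK.
Qed.

End PositiveDefiniteCone.

(** * B(G) as a Banach algebra *)

Section ComplexSequences.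
Variable R : realType.
Local Notation C := R[i].
Local Notation re := (@complex.Re R).
Local Notation im := (@complex.Im R).
Implicit Types (u v : nat -> C) (k l : C).

Lemma ReD k l : re (k + l) = re k + re l. Proof. by case: k; case: l. Qed.
Lemma ImD k l : im (k + l) = im k + im l. Proof. by case: k; case: l. Qed.
Lemma ReM k l : re (k * l) = re k * re l - im k * im l.
Proof. by case: k; case: l. Qed.
Lemma ImM k l : im (k * l) = re k * im l + im k * re l.
Proof. by case: k; case: l. Qed.
Lemma Re_sum I (r : seq I) (F : I -> C) : re (\sum_(i <- r) F i) = \sum_(i <- r) re (F i).
Proof. exact: (big_morph _ ReD). Qed.
Lemma Im_sum I (r : seq I) (F : I -> C) : im (\sum_(i <- r) F i) = \sum_(i <- r) im (F i).
Proof. exact: (big_morph _ ImD). Qed.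

Lemma Re_le_cabs k : `|re k| <= cabs k.
Proof. by case: k => a b /=; rewrite -sqrtr_sqr ler_wsqrtr// lerDl sqr_ge0. Qed.
Lemma Im_le_cabs k : `|im k| <= cabs k.
Proof. by case: k => a b /=; rewrite -sqrtr_sqr ler_wsqrtr// lerDr sqr_ge0. Qed.
Lemma cabsN k : cabs (- k) = cabs k.
Proof. by apply/complexI; rewrite -!cabsE normrN. Qed.
Lemma cabsX k n : cabs (k ^+ n) = cabs k ^+ n.
Proof. by elim: n => [|n IH]; rewrite ?expr0 ?cabs1// !exprS cabsM IH. Qed.
Lemma cabsV k : cabs k^-1 = (cabs k)^-1.
Proof. exact: Normc.normcV. Qed.
Lemma cabs_eq0 k : (cabs k == 0) = (k == 0).
Proof. by rewrite -(normr_eq0 k) cabsE -(inj_eq (@complexI R)). Qed.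
Lemma cabs_nat n : cabs (n%:R : C) = n%:R.
Proof. by rewrite -(rmorph_nat (real_complex R)) cabs_real ?ler0n. Qed.
Lemma cabsB_ge k l : cabs k - cabs l <= cabs (k - l).
Proof. by rewrite lerBlDr -{1}(subrK l k) cabsD. Qed.
Lemma cabs_le_ReIm k : cabs k <= `|re k| + `|im k|.
Proof.
rewrite -(@ler_pXn2r _ 2) ?nnegrE ?cabs_ge0 ?addr_ge0//.
case: k => a b /=; rewrite sqr_sqrtr ?addr_ge0 ?sqr_ge0// sqrrD !real_normK ?num_real//.
by rewrite lerD2r lerDl mulrn_wge0// mulr_ge0.
Qed.

(* Convergence in C is taken componentwise, so that completeness and order
   limits come from R. *)
Definition ccvg u l : Prop :=
  re (u n) @[n --> \oo] --> re l /\ im (u n) @[n --> \oo] --> im l.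

Lemma ccvg_unique u k l : ccvg u k -> ccvg u l -> k = l.
Proof.
case=> r1 i1 [r2 i2]; have := cvg_unique _ r1 r2; have := cvg_unique _ i1 i2.
by case: k l {r1 i1 r2 i2} => a b [c d] /= -> // ->.
Qed.

Lemma ccvg_cst l : ccvg (fun=> l) l.
Proof. by split; apply: cvg_cst. Qed.

Lemma ccvgD u v k l : ccvg u k -> ccvg v l -> ccvg (fun n => u n + v n) (k + l).
Proof.
case=> r1 i1 [r2 i2]; split; rewrite ?ReD ?ImD.
  by under eq_fun do rewrite ReD; exact: cvgD.
by under eq_fun do rewrite ImD; exact: cvgD.
Qed.

Lemma ccvgZ (a : C) u k : ccvg u k -> ccvg (fun n => a * u n) (a * k).
Proof.
case=> r1 i1; split; rewrite ?ReM ?ImM.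
  under eq_fun do rewrite ReM.
  by apply: cvgB; apply: cvgM => //; apply: cvg_cst.
under eq_fun do rewrite ImM.
by apply: cvgD; apply: cvgM => //; apply: cvg_cst.
Qed.

Lemma ccvg_sum (I : Type) (r : seq I) (F : nat -> I -> C) (L : I -> C) :
  (forall i, ccvg (F^~ i) (L i)) ->
  ccvg (fun n => \sum_(i <- r) F n i) (\sum_(i <- r) L i).
Proof.
move=> H; elim: r => [|i r IH].
  by under eq_fun do rewrite big_nil; rewrite big_nil; exact: ccvg_cst.
by under eq_fun do rewrite big_cons; rewrite big_cons; exact: ccvgD.
Qed.

Lemma ccvg_ge0 u k : ccvg u k -> (forall n, 0 <= u n) -> 0 <= k.
Proof.
case=> r1 i1 u0; rewrite lecE/=; apply/andP; split; last first.
  rewrite -(cvg_lim _ r1)//; apply: limr_ge; first by apply/cvg_ex; exists (re k).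
  by apply: nearW => n; have := u0 n; rewrite lecE => /andP[].
apply/eqP; apply: (cvg_unique _ i1) => //.
rewrite (_ : (fun n => _) = fun=> 0); first exact: cvg_cst.
by apply/funext => n; exact: ger0_Im.
Qed.

Lemma ccvg_le u k (l : C) : ccvg u k -> (forall n, u n <= l) -> k <= l.
Proof.
move=> uk ul; have := ccvgD (ccvg_cst l) (ccvgZ (-1) uk).
move=> /ccvg_ge0; rewrite mulN1r subr_ge0; apply=> n.
by rewrite mulN1r subr_ge0.
Qed.

Lemma ccvg0 u (e : nat -> R) : e @ \oo --> 0 -> (forall n, cabs (u n) <= e n) -> ccvg u 0.
Proof.
move=> e0 ue; have H (w : nat -> R) : (forall n, `|w n| <= e n) -> w @ \oo --> 0.
  move=> we; apply: (@squeeze_cvgr _ _ _ _ (fun n => - e n) e) => //.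
    by apply: nearW => n; rewrite -ler_norml.
  by rewrite -oppr0; apply: cvgN.
by split; apply: H => n; apply: le_trans (ue n); rewrite ?Re_le_cabs ?Im_le_cabs.
Qed.

Lemma ccvg_summable u (e : nat -> R) (s : R) : (forall n, cabs (u n) <= e n) ->
  (forall N, \sum_(0 <= n < N) e n <= s) ->
  exists l, ccvg (fun N => \sum_(0 <= n < N) u n) l.
Proof.
move=> ue es; have H (w : nat -> R) : (forall n, `|w n| <= e n) ->
    cvgn (series w).
  move=> we; apply: normed_cvg; apply: nondecreasing_is_cvgn.
    by apply/nondecreasing_seqP => n; rewrite -subr_ge0 seriesSB/= normr_ge0.
  exists s => _ [N _ <-]; apply: le_trans (es N).
  by rewrite /series/=; apply: ler_sum => n _.
exists (Complex (limn (series (re \o u))) (limn (series (im \o u)))); split=> /=.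
  under eq_fun do rewrite Re_sum.
  by apply: H => n; exact: le_trans (Re_le_cabs _) (ue n).
under eq_fun do rewrite Im_sum.
by apply: H => n; exact: le_trans (Im_le_cabs _) (ue n).
Qed.

End ComplexSequences.

(** * The decomposition norm of B(G): algebra bounds, duality and completeness *)

Section PositiveDefiniteNorm.
Variables (R : realType) (G : groupType).
Local Notation C := R[i].
Local Notation re := (@complex.Re R).
Local Notation im := (@complex.Im R).
Implicit Types (phi psi f h : G -> C) (r s : R).

(* [pd_bound f r] says that f has norm at most r for the norm
   inf { sum_j phi_j(1) | f = sum_j i^j phi_j, phi_j positive definite } of B(G);
   only fourth roots of unity occur as coefficients, so that the norm is
   submultiplicative and completeness is that of the positive definite cone. *)
Definition pd_bound f r : Prop := exists phi : 'Z_4 -> G -> C,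
  [/\ forall j, positive_definite (phi j),
      forall g, f g = \sum_(j : 'Z_4) 'i ^+ j * phi j g
    & \sum_j phi j 1%g <= r%:C%C].

Lemma pd_bound_ge0 f r : pd_bound f r -> 0 <= r.
Proof.
case=> phi [hp _ le]; rewrite -ler0c; apply: le_trans le.
by apply: sumr_ge0 => j _; exact: posdef_ge0.
Qed.

Lemma pd_bound_le f r s : r <= s -> pd_bound f r -> pd_bound f s.
Proof.
move=> rs [phi [hp E le]]; exists phi; split=> //; apply: le_trans le _.
by rewrite lecR.
Qed.

Lemma pd_bound_posdef phi : positive_definite phi -> pd_bound phi (re (phi 1%g)).
Proof.
move=> hp; exists (fun j => if j == 0 then phi else 0); split.
- by move=> j; case: eqP => // _; exact: posdef0.
- move=> g; rewrite (bigD1 0)//= big1 ?addr0 ?mul1r// => j /negPf ->.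
  by rewrite mulr0.
- rewrite (bigD1 0)//= big1 ?addr0 => [|j /negPf -> //].
  by rewrite RRe_real// ger0_real// posdef_ge0.
Qed.

Lemma pd_bound1 : pd_bound 1 1.
Proof. exact: (pd_bound_posdef (@posdef1 R G)). Qed.

Lemma pd_bound0 : pd_bound 0 0.
Proof. exact: (pd_bound_posdef (@posdef0 R G)). Qed.

Lemma pd_boundD f h r s : pd_bound f r -> pd_bound h s -> pd_bound (f + h) (r + s).
Proof.
case=> phi [hp E le] [psi [hq E' le']]; exists (fun j => phi j + psi j); split.
- by move=> j; exact: posdefD.
- move=> g; transitivity (f g + h g) => //.
  by rewrite E E' -big_split; apply: eq_bigr => j _; rewrite /= -mulrDr.
- by rewrite rmorphD big_split lerD.
Qed.

Lemma pd_boundZr (a : R) f r : 0 <= a -> pd_bound f r -> pd_bound (a%:C%C *: f) (a * r).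
Proof.
move=> a0 [phi [hp E le]]; exists (fun j => a%:C%C *: phi j); split.
- by move=> j; apply: posdefZ; rewrite ?ler0c.
- move=> g; transitivity (a%:C%C * f g) => //; rewrite E mulr_sumr; apply: eq_bigr => j _.
  by rewrite /= mulrCA.
- by rewrite rmorphM/= -mulr_sumr ler_wpM2l ?ler0c.
Qed.

Lemma exprI_Z4D (j k : 'Z_4) : 'i ^+ (j + k)%R = 'i ^+ j * 'i ^+ k :> C.
Proof.
rewrite -exprD /= /Zp_trunc/= expr_mod//.
by rewrite (_ : 4 = 2 * 2)%N// exprM sqrCi sqrrN expr1n.
Qed.

(** The product of two decompositions regroups as a convolution over ['Z_4]. Its components are
    positive definite by Schur's theorem, and the total of the values at 1 is the product of the two
    totals. *)
Lemma pd_boundM f h r s : pd_bound f r -> pd_bound h s -> pd_bound (f * h) (r * s).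
Proof.
case=> phi [hp E le] [psi [hq E' le']].
have conv (F : 'Z_4 -> 'Z_4 -> C) :
    \sum_m \sum_j F j (m - j) = \sum_j \sum_k F j k.
  rewrite exchange_big; apply: eq_bigr => j _.
  rewrite [RHS](reindex_inj (addIr (- j)))/=.
  by apply: eq_bigr => m _.
exists (fun m => \sum_j phi j * psi (m - j)); split.
- by move=> m; apply: posdef_sum => j; exact: posdefM.
- move=> g; transitivity (f g * h g) => //; rewrite E E' mulr_suml.
  rewrite [RHS](eq_bigr (fun m : 'Z_4 =>
      \sum_(j : 'Z_4) ('i ^+ j * phi j g) * ('i ^+ (m - j)%R * psi (m - j) g))).
    by rewrite (conv (fun j k : 'Z_4 => ('i ^+ j * phi j g) * ('i ^+ k * psi k g)));
      apply: eq_bigr => j _; rewrite mulr_sumr.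
  move=> m _; rewrite fct_sumE mulr_sumr; apply: eq_bigr => j _.
  rewrite -{1}(subrKC j m) (exprI_Z4D j (m - j)).
  by rewrite (_ : (phi j * psi (m - j)) g = phi j g * psi (m - j) g)//; ring.
- rewrite (eq_bigr (fun m => \sum_j phi j 1%g * psi (m - j) 1%g)); last first.
    by move=> m _; rewrite fct_sumE.
  rewrite (conv (fun j k => phi j 1%g * psi k 1%g)).
  under eq_bigr do rewrite -mulr_sumr.
  rewrite -mulr_suml rmorphM/= ler_pM// sumr_ge0// => j _; exact: posdef_ge0.
Qed.

(** Multiplication by ['i] only permutes the four components cyclically. *)
Lemma pd_boundI f r : pd_bound f r -> pd_bound ('i *: f) r.
Proof.
move=> [phi [hp E le]]; exists (fun j => phi (j - 1)); split=> //.
  move=> g; transitivity ('i * f g) => //; rewrite E mulr_sumr [RHS](reindex_inj (addIr 1)) /=.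
  by apply: eq_bigr => j _; rewrite addrK (exprI_Z4D j 1) expr1 mulrA ['i * _]mulrC.
by rewrite (reindex_inj (addIr 1))/=; under eq_bigr do rewrite addrK.
Qed.

Lemma pd_boundIn f r (n : nat) : pd_bound f r -> pd_bound ('i ^+ n *: f) r.
Proof.
move=> fr; elim: n => [|n IH]; first by rewrite scale1r.
by rewrite exprS -scalerA; exact: pd_boundI.
Qed.

Lemma pd_boundN f r : pd_bound f r -> pd_bound (- f) r.
Proof. by move=> /(pd_boundIn 2); rewrite sqrCi scaleN1r. Qed.

(** The factor 2 comes from splitting [c] into real and imaginary parts, each of modulus at most
    [cabs c]. *)
Lemma pd_boundZ (c : C) f r : pd_bound f r -> pd_bound (c *: f) (2 * cabs c * r).
Proof.
move=> fr; have r0 := pd_bound_ge0 fr.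
have Zreal (a : R) : pd_bound (a%:C%C *: f) (`|a| * r).
  have [a0|a0] := leP 0 a; first by rewrite ger0_norm//; exact: pd_boundZr.
  have := pd_boundN (pd_boundZr (_ : 0 <= - a) fr); rewrite rmorphN scaleNr opprK.
  by rewrite ltr0_norm// oppr_ge0; apply; exact: ltW.
have -> : c = (re c)%:C%C + 'i * (im c)%:C%C by rewrite {1}[c]complexE.
rewrite scalerDl -scalerA; apply: pd_bound_le (pd_boundD (Zreal _) (pd_boundI (Zreal _))).
rewrite -mulrDl ler_wpM2r// mulr_natl mulr2n -complexE.
by rewrite lerD ?Re_le_cabs ?Im_le_cabs.
Qed.

Lemma pd_bound_sum (I : Type) (t : seq I) (F : I -> G -> C) (r : I -> R) :
  (forall i, pd_bound (F i) (r i)) ->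
  pd_bound (\sum_(i <- t) F i) (\sum_(i <- t) r i).
Proof.
move=> H; elim: t => [|i t IH]; first by rewrite !big_nil; exact: pd_bound0.
by rewrite !big_cons; exact: pd_boundD.
Qed.

Lemma BG_pd_bound f : BG f <-> exists r, pd_bound f r.
Proof.
split=> [[n [c [phi [hp ->]]]]|[r [phi [hp E _]]]].
  exists (\sum_(i < n) 2 * cabs (c i) * re (phi i 1%g)).
  by apply: pd_bound_sum => i; exact/pd_boundZ/pd_bound_posdef.
exists 4%N, (fun j => 'i ^+ j), phi; split=> //; apply/funext => g.
by rewrite E fct_sumE.
Qed.

Lemma pd_bound_cabs f r g : pd_bound f r -> cabs (f g) <= r.
Proof.
case=> phi [hp E le]; rewrite -lecR -cabsE E; apply: le_trans le.
apply: (le_trans (ler_norm_sum _ _ _)); apply: ler_sum => j _.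
by rewrite normrM normrX normCi expr1n mul1r posdef_le.
Qed.

(** Through this estimate the decomposition norm dominates the norm of C*(G)^*, so that elements of
    W*(G) can be bounded on B(G). *)
Lemma pd_bound_pairing f r (x : {malg C[G]}) :
  pd_bound f r -> cabs (pairing f x) <= r * Cstar_norm x.
Proof.
case=> phi [hp E le].
have -> : pairing f x = \sum_(j : 'Z_4) 'i ^+ j * pairing (phi j) x.
  rewrite /pairing; under eq_bigr do rewrite E mulr_suml.
  rewrite exchange_big; apply: eq_bigr => j _; rewrite mulr_sumr.
  by apply: eq_bigr => g _; rewrite mulrA.
apply: (@le_trans _ _ ((\sum_j re (phi j 1%g)) * Cstar_norm x)); last first.
  rewrite ler_wpM2r ?Cstar_norm_ge0// -Re_sum.
  by have := le; rewrite lecE => /andP[].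
rewrite -lecR -cabsE; apply: (le_trans (ler_norm_sum _ _ _)).
rewrite mulr_suml rmorph_sum; apply: ler_sum => j _.
by rewrite normrM normrX normCi expr1n mul1r cabsE lecR posdef_pairing_le.
Qed.

Lemma pd_bound_dual f r : pd_bound f r -> f \in @Cstar_dual_pred R G.
Proof. by move=> fr; apply/asboolP; exists r => x; exact: pd_bound_pairing. Qed.

Lemma pd_bound_dual_norm (f : Cstar_dual R G) r : pd_bound f r -> dual_norm f <= r.
Proof.
move=> fr; apply: dual_norm_le => [|x]; first exact: pd_bound_ge0 fr.
exact: pd_bound_pairing.
Qed.

(** Completeness in a pointwise form. Each of the four components is dominated by [r n], so it can
    be summed separately; positive definiteness passes to pointwise limits, being a family of closed
    inequalities. *)
Lemma pd_bound_series (u : nat -> G -> C) (r : nat -> R) s f :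
  (forall n, pd_bound (u n) (r n)) -> (forall N, \sum_(0 <= n < N) r n <= s) ->
  (forall g, ccvg (fun N => \sum_(0 <= n < N) u n g) (f g)) -> pd_bound f s.
Proof.
move=> /choice[phi H] rs uf.
have sub n j g : cabs (phi n j g) <= r n.
  have [hp E le] := H n; rewrite -lecR -cabsE.
  apply: (le_trans (posdef_le g (hp j))); apply: le_trans le.
  rewrite (bigD1 j)//= lerDl; apply: sumr_ge0 => k _; exact: posdef_ge0.
have : forall jg : 'Z_4 * G, exists l,
    ccvg (fun N => \sum_(0 <= n < N) phi n jg.1 jg.2) l.
  by move=> [j g]; exact: (ccvg_summable (fun n => sub n j g) rs).
move=> /choice[L HL]; pose Phi j g := L (j, g).
have PhiP j g : ccvg (fun N => \sum_(0 <= n < N) phi n j g) (Phi j g) by exact: (HL (j, g)).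
exists Phi; split.
- move=> j n c g; apply: (@ccvg_ge0 _ (fun N => \sum_(a < n) \sum_(b < n)
      (c a)^* * c b * \sum_(0 <= k < N) phi k j ((g a)^-1 * g b)%g)).
    by apply: ccvg_sum => a; apply: ccvg_sum => b; exact: ccvgZ.
  move=> N; rewrite (eq_bigr (fun a => \sum_(0 <= k < N) \sum_(b < n)
      (c a)^* * c b * phi k j ((g a)^-1 * g b)%g)); last first.
    by move=> a _; under eq_bigr do rewrite mulr_sumr; rewrite exchange_big.
  rewrite exchange_big; apply: sumr_ge0 => k _.
  by have [hp _ _] := H k; exact: hp.
- move=> g; apply: (ccvg_unique (uf g)).
  have -> : (fun N => \sum_(0 <= n < N) u n g) =
      (fun N => \sum_(j : 'Z_4) 'i ^+ j * \sum_(0 <= n < N) phi n j g).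
    apply/funext => N; under [RHS]eq_bigr do rewrite mulr_sumr.
    by rewrite exchange_big; apply: eq_bigr => n _; have [_ E _] := H n; rewrite E.
  by apply: ccvg_sum => j; exact: ccvgZ.
- apply: (@ccvg_le _ (fun N => \sum_j \sum_(0 <= n < N) phi n j 1%g)).
    by apply: ccvg_sum => j; exact: PhiP.
  move=> N; rewrite exchange_big; apply: (@le_trans _ _ (\sum_(0 <= n < N) (r n)%:C%C)).
    by apply: ler_sum => n _; have [_ _ le] := H n.
  by rewrite -rmorph_sum lecR.
Qed.

End PositiveDefiniteNorm.

(** * Resolvents on the unit circle *)

Section CompactCircle.
Variable R : realType.
Local Notation C := R[i].

Lemma compact_circle : compact [set p : R * R | p.1 ^+ 2 + p.2 ^+ 2 = 1].
Proof.
have box : compact (`[(-1 : R), 1] `*` `[(-1 : R), 1])%classic.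
  by apply: compact_setX; exact: segment_compact.
apply: (subclosed_compact _ box) => [|[x y] /= xy1].
  apply: (@preimage_closed _ _ (fun p : R * R => p.1 ^+ 2 + p.2 ^+ 2) [set x | x = 1]);
    last exact: closed_eq.
  move=> p _; apply: cvgD.
    by apply: (@continuous_comp _ _ _ fst (fun x : R => x ^+ 2));
      [exact: cvg_fst|exact: exprn_continuous].
  by apply: (@continuous_comp _ _ _ snd (fun x : R => x ^+ 2));
    [exact: cvg_snd|exact: exprn_continuous].
have H (a b : R) : a ^+ 2 + b ^+ 2 = 1 -> -1 <= a <= 1.
  move=> ab; rewrite -ler_norml -(@expr_le1 _ 2)// real_normK ?num_real//.
  by rewrite -ab lerDl sqr_ge0.
split; rewrite /= in_itv/=; first exact: H xy1.
by apply: (H y x); rewrite addrC.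
Qed.

(** Compactness in near-covering form, with parameter an integer tending to infinity: the local
    bounds are eventually below a single [N]. *)
Lemma circle_uniform_bound (P : C -> R -> Prop) :
  (forall z r s, r <= s -> P z r -> P z s) ->
  (forall z, cabs z = 1 -> exists r, exists2 d, 0 < d &
     forall z', cabs z' = 1 -> cabs (z' - z) < d -> P z' r) ->
  exists r, forall z, cabs z = 1 -> P z r.
Proof.
move=> Pmono Ploc.
have /compact_near_coveringP/near_covering_withinP cK := compact_circle.
have onK (p : R * R) : (p.1 ^+ 2 + p.2 ^+ 2 = 1) <-> cabs (Complex p.1 p.2) = 1.
  rewrite /=; split=> [->|E]; first by rewrite sqrtr1.
  by rewrite -[LHS]sqr_sqrtr ?addr_ge0 ?sqr_ge0// E expr1n.
have := cK nat \oo (fun n p => P (Complex p.1 p.2) n%:R) _.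
case=> [p /onK pK|N _ HN]; last first.
  exists N%:R => -[x y] z1; apply: (HN N _ (x, y)) => //=.
  exact/(onK (x, y)).
have [r [d d0 H]] := Ploc _ pK.
have near1 : \forall p' \near p, `|p.1 - p'.1| < d / 2.
  have /cvgrPdist_lt : p'.1 @[p' --> p] --> p.1 by exact: cvg_fst.
  by apply; rewrite divr_gt0.
have near2 : \forall p' \near p, `|p.2 - p'.2| < d / 2.
  have /cvgrPdist_lt : p'.2 @[p' --> p] --> p.2 by exact: cvg_snd.
  by apply; rewrite divr_gt0.
near=> q n => /= /onK qK.
apply: (Pmono _ r); first by near: n; exact: nbhs_infty_ger.
apply: H => //; apply: (le_lt_trans (cabs_le_ReIm _)).
rewrite [d]splitr ltrD//=; rewrite distrC.
  by near: q.
by near: q.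
Unshelve. all: by end_near. Qed.

End CompactCircle.

(** * Inversion by Neumann series in B(G) *)

Section NeumannSeries.
Variables (R : realType) (G : groupType).
Local Notation C := R[i].
Implicit Types (f h : G -> C) (r s : R).

Lemma pd_bound_exp h r n : pd_bound h r -> pd_bound (h ^+ n) (r ^+ n).
Proof.
move=> hr; elim: n => [|n IH]; first exact: pd_bound1.
by rewrite !exprS; exact: pd_boundM.
Qed.

Lemma ccvg_dist (u : nat -> C) (e : nat -> R) l : e @ \oo --> 0 ->
  (forall n, cabs (u n - l) <= e n) -> ccvg u l.
Proof.
move=> e0 ue; have := ccvgD (ccvg0 e0 ue) (ccvg_cst l); rewrite add0r.
by under eq_fun do rewrite subrK.
Qed.

Lemma cabs_lt1_neq (z : C) : cabs z < 1 -> 1 - z != 0.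
Proof. by apply: contraTneq => /subr0_eq <-; rewrite cabs1 ltxx. Qed.

Lemma geometric_sum (K : fieldType) (x : K) N : 1 - x != 0 ->
  \sum_(0 <= n < N) x ^+ n = (1 - x ^+ N) / (1 - x).
Proof.
move=> x1; apply: (canRL (mulfK x1)).
by rewrite big_mkord -[1 - x ^+ N]opprB subrX1; ring.
Qed.

Lemma geometric_sum_le r N : 0 <= r -> r < 1 ->
  \sum_(0 <= n < N) r ^+ n <= (1 - r)^-1.
Proof.
move=> r0 r1; rewrite geometric_sum ?subr_eq0 ?gt_eqF//.
by rewrite ler_pdivrMr ?subr_gt0// mulVf ?subr_eq0 ?gt_eqF// gerBl exprn_ge0.
Qed.

(** The powers of [h] are summable for the decomposition norm; pointwise they form a geometric
    series, as [|h g| <= r < 1]. *)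
Lemma pd_bound_neumann h r : r < 1 -> pd_bound h r ->
  pd_bound (fun g => (1 - h g)^-1) (1 - r)^-1.
Proof.
move=> r1 hr; have r0 := pd_bound_ge0 hr.
apply: (pd_bound_series (fun n => pd_bound_exp n hr)) => [N|g].
  exact: geometric_sum_le.
have hg : cabs (h g) <= r := pd_bound_cabs g hr.
have h1 : 1 - h g != 0 by apply: cabs_lt1_neq; exact: le_lt_trans r1.
apply: (@ccvg_dist _ (fun N => r ^+ N * cabs (1 - h g)^-1)).
  rewrite -(mul0r (cabs (1 - h g)^-1)); apply: cvgM; last exact: cvg_cst.
  by apply: cvg_expr; rewrite ger0_norm.
move=> N; rewrite (eq_bigr (fun n => h g ^+ n)) => [|n _]; last by rewrite exprfctE.
rewrite geometric_sum// -[X in _ - X]mul1r -mulrBl cabsM ler_wpM2r ?cabs_ge0//.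
rewrite addrC addrA addNr add0r cabsN.
by rewrite cabsX lerXn2r// nnegrE ?cabs_ge0.
Qed.

End NeumannSeries.

(** * Dyadic roots of unity approaching 1 *)

Section DyadicRoots.
Variable R : realType.
Local Notation C := R[i].

(** A primitive [2^(k+1)]-th root of unity. Square roots are principal, so the real part is
    nonnegative from [k = 1] on. *)
Fixpoint dyadic_root (k : nat) : C :=
  if k is k'.+1 then sqrtc (dyadic_root k') else -1.

Lemma dyadic_rootE k : dyadic_root k ^+ (2 ^ k) = -1.
Proof. by elim: k => [|k IH]; rewrite ?expr1// expnS exprM sqr_sqrtc. Qed.

Lemma cabs_dyadic_root k : cabs (dyadic_root k) = 1.
Proof.
elim: k => [|k IH]; first by rewrite [dyadic_root 0]/= cabsN cabs1.
have : cabs (dyadic_root k.+1) ^+ 2 = 1 by rewrite -cabsX sqr_sqrtc.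
by move=> /eqP; rewrite sqrf_eq1 => /orP[/eqP//|/eqP E]; have := cabs_ge0 (dyadic_root k.+1);
  rewrite E oppr_ge0 ler10.
Qed.

Lemma cabs_add1_sq (z : C) : cabs z = 1 -> 0 <= complex.Re z -> 2 <= cabs (z + 1) ^+ 2.
Proof.
case: z => u v /= uv u0; move/eqP: uv; rewrite -(@eqrXn2 _ 2)//; last exact: sqrtr_ge0.
by rewrite expr1n addr0 !sqr_sqrtr ?addr_ge0 ?sqr_ge0// => /eqP; nra.
Qed.

(** As [(z - 1)(z + 1) = z^2 - 1] and [|z + 1|^2 >= 2], hence [|z + 1| >= 5/4], each square root
    shrinks the distance to 1 by a factor [4/5] at least. *)
Lemma dyadic_root_near1 k : cabs (dyadic_root k - 1) <= 2 * (4 / 5) ^+ k.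
Proof.
elim: k => [|k IH].
  by rewrite [dyadic_root 0]/= -opprD cabsN -(natrD _ 1 1) cabs_nat expr0 mulr1.
set z := dyadic_root k.+1; have z1 : cabs z = 1 := cabs_dyadic_root k.+1.
have zz : cabs (z - 1) * cabs (z + 1) = cabs (dyadic_root k - 1).
  by rewrite -cabsM -subr_sqr expr1n sqr_sqrtc.
have z5 : 5 / 4 <= cabs (z + 1).
  have : 2 <= cabs (z + 1) ^+ 2.
    apply: cabs_add1_sq => //; rewrite /z/=; case: (dyadic_root k) => u v.
    exact: sqrtr_ge0.
  move=> H; rewrite leNgt; apply/negP => H1; have := cabs_ge0 (z + 1); nra.
have := cabs_ge0 (z - 1); rewrite exprS; nra.
Qed.

End DyadicRoots.

(** * Averaged resolvents and their limit *)

Section CircleResolvent.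
Variables (R : realType) (G : groupType) (a : G -> R[i]) (alpha : R).
Local Notation C := R[i].
Hypothesis a_bound : pd_bound a alpha.
Hypothesis a_neq1 : forall g, cabs (a g) != 1.

Definition resolvent (z : C) : G -> C := fun g => (1 - z * a g)^-1.

Hypothesis resolventP : forall z, cabs z = 1 -> exists r, pd_bound (resolvent z) r.

Lemma halfE : (1 / 2)%:C%C = 1 / 2%:R :> C.
Proof. by rewrite rmorphM fmorphV rmorph1 rmorph_nat. Qed.

Lemma subr1_neq0 (z : C) n g : cabs z = 1 -> 1 - (z * a g) ^+ n.+1 != 0.
Proof.
move=> z1; apply: contraTneq (a_neq1 g) => /subr0_eq /esym E.
have : cabs (a g) ^+ n.+1 = 1.
  by rewrite -cabsX -[RHS](cabs1 R) -E exprMn cabsM !cabsX z1 expr1n mul1r.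
by move/eqP; rewrite pexprn_eq1 ?cabs_ge0// negbK.
Qed.

Lemma subr1z_neq0 (z : C) g : cabs z = 1 -> 1 - z * a g != 0.
Proof. exact: (@subr1_neq0 z 0 g). Qed.

(** Locally, [resolvent z'] is [resolvent z] times a Neumann series in [(z' - z) a resolvent z];
    compactness of the circle makes the bound uniform. *)
Lemma resolvent_uniform : exists r, forall z, cabs z = 1 -> pd_bound (resolvent z) r.
Proof.
apply: circle_uniform_bound => [z r s|z z1]; first exact: pd_bound_le.
have [r zr] := resolventP z1; exists (r * (1 - 1 / 2)^-1).
have ar0 : 0 <= alpha * r.
  by rewrite mulr_ge0 ?(pd_bound_ge0 a_bound)// (pd_bound_ge0 zr).
(* This radius gives [2 |z' - z| alpha r <= 1/2], where 2 is the loss in [pd_boundZ]; the [+ 1]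
   keeps the denominator positive. *)
exists ((4 * (alpha * r + 1))^-1); first by rewrite invr_gt0 mulr_gt0// ltr_wpDl.
move=> z' z'1 zz'; have dist : pd_bound ((z' - z) *: (a * resolvent z)) (1 / 2).
  apply: pd_bound_le (pd_boundZ _ (pd_boundM a_bound zr)).
  have p4 : 0 < 4 * (alpha * r + 1) by rewrite mulr_gt0// ltr_wpDl.
  move: zz'; rewrite -[X in _ < X]mul1r ltr_pdivlMr// => zz'.
  have := cabs_ge0 (z' - z); nra.
have -> : resolvent z' = resolvent z *
    (fun g => (1 - ((z' - z) *: (a * resolvent z)) g)^-1).
  apply/funext => g; transitivity ((1 - z * a g)^-1 *
      (1 - (z' - z) * (a g * (1 - z * a g)^-1))^-1) => //.
  rewrite -invfM; congr (_^-1); have := subr1z_neq0 g z1 => n0.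
  by field.
apply: pd_boundM zr _; apply: pd_bound_neumann => //; lra.
Qed.

(** The resolvent identity, combined with the uniform bound. *)
Lemma resolvent_lipschitz : exists K, forall z z', cabs z = 1 -> cabs z' = 1 ->
  pd_bound (resolvent z - resolvent z') (K * cabs (z - z')).
Proof.
have [r H] := resolvent_uniform; exists (2 * (alpha * (r * r))) => z z' z1 z'1.
have -> : resolvent z - resolvent z' =
    (z - z') *: (a * (resolvent z * resolvent z')).
  apply/funext => g; transitivity ((1 - z * a g)^-1 - (1 - z' * a g)^-1) => //.
  transitivity ((z - z') * (a g * ((1 - z * a g)^-1 * (1 - z' * a g)^-1))) => //.
  have n0 := subr1z_neq0 g z1; have n1 := subr1z_neq0 g z'1.
  by field; rewrite n0 n1.
rewrite mulrAC; apply: pd_boundZ; apply: pd_boundM => //.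
by apply: pd_boundM; exact: H.
Qed.

(* The average of the resolvents at the points z w, w ranging over the 2^k-th
   roots of unity. *)
Definition dyadic_average k (z : C) : G -> C := fun g => (1 - (z * a g) ^+ (2 ^ k))^-1.

(** With [x = (z a)^(2^k)], this is [1/(1 - x^2) = (1/(1 - x) + 1/(1 + x))/2]: the factor
    [dyadic_root k] turns [x] into [- x]. *)
Lemma dyadic_averageS k z : cabs z = 1 -> dyadic_average k.+1 z =
  (1 / 2)%:C%C *: (dyadic_average k z + dyadic_average k (dyadic_root R k * z)).
Proof.
move=> z1; apply/funext => g; transitivity ((1 / 2)%:C%C *
  ((1 - (z * a g) ^+ (2 ^ k))^-1 +
   (1 - (dyadic_root R k * z * a g) ^+ (2 ^ k))^-1)) => //.
rewrite -mulrA [X in _ + (1 - X)^-1]exprMn dyadic_rootE mulN1r opprK.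
rewrite /dyadic_average expnSr exprM.
have e2 n : exists m, (2 ^ n = m.+1)%N by exists (2 ^ n).-1; rewrite prednK// expn_gt0.
have [m Em] := e2 k; have [m' Em'] := e2 k.+1.
have n0 : 1 - (z * a g) ^+ (2 ^ k) != 0 by rewrite Em subr1_neq0.
have : 1 - (z * a g) ^+ (2 ^ k.+1) != 0 by rewrite Em' subr1_neq0.
rewrite expnSr exprM; move: (_ ^+ (2 ^ k)) n0 => x n0 n1.
have E : 1 - x ^+ 2 = (1 + x) * (1 - x) by ring.
have n2 : 1 + x != 0 by apply: contraNneq n1 => x1; rewrite E x1 mul0r.
rewrite E; rewrite halfE.
by field; rewrite n0 n2.
Qed.

(** Rotations preserve distances and averaging does not increase a Lipschitz constant, so one [K]
    serves all [k]. *)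
Lemma dyadic_average_lipschitz : exists K, forall k z z', cabs z = 1 -> cabs z' = 1 ->
  pd_bound (dyadic_average k z - dyadic_average k z') (K * cabs (z - z')).
Proof.
have [K HK] := resolvent_lipschitz; exists K; elim=> [|k IH] z z' z1 z'1.
  have E w : dyadic_average 0 w = resolvent w.
    by apply/funext => g; rewrite /dyadic_average expn0 expr1.
  by rewrite !E; exact: HK.
have w1 := cabs_dyadic_root R k.
rewrite !dyadic_averageS// -scalerBr opprD addrACA.
have H := IH _ _ z1 z'1; have H' := IH (dyadic_root R k * z) (dyadic_root R k * z').
apply: pd_bound_le (pd_boundZr _ (pd_boundD H (H' _ _))).
- by rewrite -mulrBr cabsM w1 mul1r; lra.
- lra.
- by rewrite cabsM w1 z1 mulr1.
- by rewrite cabsM w1 z'1 mulr1.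
Qed.

Definition small_indicator : G -> C := fun g => (cabs (a g) < 1)%R%:R.

Lemma cvg_expr_shift (b c : R) n : 0 <= b -> b < 1 ->
  (fun N => b ^+ (n + N) * c) @ \oo --> 0.
Proof.
move=> b0 b1; rewrite -(mul0r c) -(mulr0 (b ^+ n)); apply: cvgM; last exact: cvg_cst.
under eq_fun do rewrite exprD; apply: cvgM; first exact: cvg_cst.
by apply: cvg_expr; rewrite ger0_norm.
Qed.

(** Uses [2^m >= m] in the numerator and [2^m >= 1] in the denominator, leaving a plain geometric
    rate in [m]. *)
Lemma cabs_geo_le (x : C) m : cabs x < 1 ->
  cabs (x ^+ (2 ^ m) / (1 - x ^+ (2 ^ m))) <= cabs x ^+ m * (1 - cabs x)^-1.
Proof.
move=> x1; have x0 := cabs_ge0 x.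
have xle n : (m <= n)%N -> cabs x ^+ n <= cabs x ^+ m.
  by move=> mn; rewrite ler_wiXn2l// ltW.
rewrite cabsM cabsX cabsV ler_pM ?exprn_ge0 ?invr_ge0 ?cabs_ge0//.
  by apply: xle; exact/ltnW/ltn_expl.
rewrite lef_pV2 ?posrE ?subr_gt0//; last first.
  rewrite lt_def cabs_ge0 andbT cabs_eq0; apply: cabs_lt1_neq.
  by rewrite cabsX exprn_ilt1// -lt0n expn_gt0.
apply: le_trans (cabsB_ge _ _); rewrite cabs1 lerD2l lerN2 cabsX.
rewrite -[leRHS]expr1 ler_wiXn2l ?expn_gt0//; exact: ltW.
Qed.

Lemma ccvg_dyadic_average n g :
  ccvg (fun N => dyadic_average (n + N) 1 g) (small_indicator g).
Proof.
rewrite /small_indicator /dyadic_average; under eq_fun do rewrite mul1r.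
have [a1|a1] := ltP (cabs (a g)) 1; rewrite ?mulr1n ?mulr0n.
  apply: (ccvg_dist (@cvg_expr_shift _ (1 - cabs (a g))^-1 n (cabs_ge0 _) a1)) => N.
  apply: le_trans (cabs_geo_le (n + N) a1).
  set t := a g ^+ _; have t0 : 1 - t != 0.
    by apply: cabs_lt1_neq; rewrite cabsX exprn_ilt1 ?cabs_ge0// -lt0n expn_gt0.
  by rewrite (_ : _ - _ = t / (1 - t))//; field.
(* Where [|a g| > 1], the identity [(1 - t)^-1 = - t^-1 / (1 - t^-1)] allows the same estimate for
   the inverse of [a g]. *)
have b1 : cabs (a g)^-1 < 1.
  by rewrite cabsV invf_lt1 ?(lt_le_trans ltr01 a1)// lt_def a_neq1.
apply: (ccvg_dist (@cvg_expr_shift _ (1 - cabs (a g)^-1)^-1 n (cabs_ge0 _) b1)) => N.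
apply: le_trans (cabs_geo_le (n + N) b1).
have a0 : a g != 0 by rewrite -cabs_eq0 gt_eqF// (lt_le_trans ltr01 a1).
rewrite exprVn subr0; set t := a g ^+ _; have t0 : t != 0 by rewrite expf_neq0.
have t1 : 1 - t^-1 != 0.
  by apply: cabs_lt1_neq; rewrite -exprVn cabsX exprn_ilt1 ?cabs_ge0// -lt0n expn_gt0.
have t2 : t - 1 != 0.
  by apply: contraNneq t1 => /subr0_eq ->; rewrite invr1 subrr.
rewrite (_ : t^-1 / (1 - t^-1) = - (1 - t)^-1) ?cabsN//.
by field; rewrite t0 t2 -opprB oppr_eq0 t2.
Qed.

(** Consecutive averages at 1 differ by half the variation of [dyadic_average m] between
    [dyadic_root m] and 1, which is at most [K (4/5)^m]. The differences telescope to the pointwise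
    limit, and 5 is the sum of the powers of [4/5]. *)
Lemma dyadic_average_approx : exists B, forall n,
  pd_bound (small_indicator - dyadic_average n 1) (B * (4 / 5) ^+ n).
Proof.
have [K HK] := dyadic_average_lipschitz; exists (5 * K) => n.
have K0 : 0 <= K.
  have := pd_bound_ge0 (HK 0%N 1 (-1) _ _); rewrite cabsN cabs1 => /(_ erefl erefl).
  by rewrite opprK -(natrD _ 1 1) cabs_nat pmulr_lge0.
have step m : pd_bound (dyadic_average m.+1 1 - dyadic_average m 1) (K * (4 / 5) ^+ m).
  have w1 := cabs_dyadic_root R m.
  have -> : dyadic_average m.+1 1 - dyadic_average m 1 =
      (1 / 2)%:C%C *: (dyadic_average m (dyadic_root R m) - dyadic_average m 1).
    rewrite dyadic_averageS ?cabs1// mulr1; apply/funext => g.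
    set A := dyadic_average m 1; set B := dyadic_average m _.
    transitivity ((1 / 2)%:C%C * (A g + B g) - A g) => //.
    transitivity ((1 / 2)%:C%C * (B g - A g)) => //.
    by rewrite halfE; field.
  apply: pd_bound_le (pd_boundZr _ (HK m _ _ w1 (cabs1 _))); last lra.
  rewrite mulrCA ler_wpM2l//; have := dyadic_root_near1 R m; lra.
apply: (@pd_bound_series _ _ (fun m => dyadic_average (n + m).+1 1 - dyadic_average (n + m) 1)
  (fun m => K * (4 / 5) ^+ (n + m))) => [m|N|g].
- exact: step.
- under eq_bigr do rewrite exprD mulrA.
  rewrite -mulr_sumr [leLHS]mulrC [5 * K]mulrC -mulrA [leRHS]mulrA mulrC.
  rewrite [K * 5 * _]mulrAC ler_wpM2l ?mulr_ge0 ?exprn_ge0 ?divr_ge0//.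
  apply: le_trans (geometric_sum_le _ _ _) _; [lra|lra|].
  by rewrite (_ : 1 - 4 / 5 = 5^-1) ?invrK//; lra.
- have := ccvgD (ccvg_dyadic_average n g) (ccvg_cst (- dyadic_average n 1 g)).
  set F := (X in ccvg X _ -> _); set F' := (X in _ -> ccvg X _).
  suff -> : F = F' by [].
  apply/funext => N; rewrite /F /F'.
  rewrite (eq_bigr (fun m => dyadic_average (n + m.+1) 1 g - dyadic_average (n + m) 1 g)).
    by rewrite (telescope_sumr (fun m => dyadic_average (n + m) 1 g))// addn0.
  by move=> m _; rewrite addnS.
Qed.

End CircleResolvent.

(** * Singular elements *)

Section Singular.
Variables (R : realType) (G : groupType).
Local Notation C := R[i].
Local Notation D := (Cstar_dual R G).
Local Notation W := (Wstar R G).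
Implicit Types (u w z : W) (f phi : D) (g h k : G).

Lemma Weval_subproof k : (fun f : D => f k) \in @Wstar_pred R G.
Proof.
apply/asboolP; split=> [a f f' //|]; exists 1 => f.
by rewrite mul1r dual_eval_le.
Qed.

(** The canonical image of the group element [k] in W*(G). *)
Definition Weval k : W := WStar (Weval_subproof k).

Lemma central_support_uniq (f : G -> C) z z' :
  central_support f z -> central_support f z' -> z = z'.
Proof.
case=> phi E [zc zv zmin] [phi' E' [zc' zv' zmin']].
have {E'}e : phi' = phi by apply/val_inj; rewrite /= -E -E'.
subst phi'; rewrite -(zmin _ zc' zv') -[RHS](zmin' _ zc zv).
by case: zc.
Qed.

(** If [z] is the support of [f], then [z w = 0], so [w u = (1 - z) w u], where [f] vanishes. *)
Lemma singular_vanish f w u :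
  singular f -> central_support (@delta_e R G) w -> (w * u) f = 0.
Proof.
case=> z [w' [[f' E [[_ _ zc] zv _]] sw' zw]] sw.
have {E}-> : f = f' by apply/val_inj.
rewrite (central_support_uniq sw' sw) in zw.
by have := zv (w * u); rewrite mulrBl mul1r mulrA zw mul0r subr0.
Qed.

(** Multiplication by [w] does not change values at [delta_e], and translation carries the value of
    [w k] at [delta_g] to that of [w (k g^-1)] at [delta_e]. *)
Lemma central_support_delta w (d : G -> D) :
  (forall g h, d g h = (h == g)%:R) -> central_support (@delta_e R G) w ->
  forall g k, (w * Weval k) (d g) = (g == k)%:R.
Proof.
move=> dE [de E [_ wv _]] g k.
have := wv (Weval (k * g^-1)%g); rewrite mulrBl mul1r => /subr0_eq /esym.
rewrite -[RHS]/(de _) -E /delta_e mulg_eq1 invgK eq_sym => <-.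
change (w (arens (Weval k) (d g)) = w (arens (Weval (k * g^-1)%g) de)).
congr (w _); apply/val_inj/funext => h.
rewrite -[LHS]/(d g (h * k)%g) -[RHS]/(de (h * (k * g^-1))%g) dE -E /delta_e.
by rewrite mulgA mulg_eq1 invgK.
Qed.

Lemma finite_support_eval (L : W) (d : G -> D) k f (s : seq G) :
  (forall g h, d g h = (h == g)%:R) -> (forall g, L (d g) = (g == k)%:R) ->
  (forall g, g \notin s -> f g = 0) -> L f = f k.
Proof.
move=> dE Ld fs.
have valD (F : G -> D) h : (\sum_(g <- undup s) F g : D) h = \sum_(g <- undup s) F g h.
  by elim/big_rec2: _ => // g x y _ <-.
(* [undup] keeps repeated entries of [s] from being counted twice. *)
have -> : f = \sum_(g <- undup s) f g *: d g.
  apply/val_inj/funext => h /=; rewrite valD.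
  rewrite (eq_bigr (fun g => f g * (h == g)%:R)) => [|g _]; last by rewrite -dE.
  have [hs|hs] := boolP (h \in undup s).
    rewrite (bigD1_seq h)//= ?undup_uniq// eqxx mulr1 big1 ?addr0// => g.
    by rewrite eq_sym => /negPf ->; rewrite mulr0.
  rewrite fs; last by rewrite mem_undup in hs.
  rewrite big_seq big1// => g gs; case: eqP => [e|_]; last by rewrite mulr0.
  by rewrite e gs in hs.
rewrite raddf_sum valD; apply: eq_bigr => g _ /=.
by rewrite linearZ /= Ld eq_sym -dE.
Qed.

End Singular.

(** * Natural spectrum, and gaps in the moduli of a function in c_0 *)

Section NaturalSpectrum.
Variables (R : realType) (G : groupType).
Local Notation C := R[i].
Implicit Types (f : G -> C).

(** Such a [mu] is outside the closure of the range, hence outside the spectrum; an inverse in B(G)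
    must be the pointwise one. *)
Lemma NS_resolvent f (mu : C) (d : R) : NS f -> 0 < d ->
  (forall g, d <= cabs (mu - f g)) -> BG (fun g => (mu - f g)^-1).
Proof.
case=> _ sf d0 fd; have : ~ spectrum f mu.
  rewrite sf => /(_ (ball (mu : C^o) d%:C%C)) [].
    by apply: nbhsx_ballx; rewrite ltcR.
  move=> _ [[g _ <-]]; rewrite -ball_normE /=.
  by rewrite cabsE ltcR ltNge fd.
rewrite /spectrum /= => /contrapT[h hB hE].
suff -> : (fun g => (mu - f g)^-1) = h by [].
apply/funext => g; have /(congr1 (@^~ g)) hg := hE.
have {}hg : (mu - f g) * h g = 1 by [].
have n0 : mu - f g != 0.
  by apply/eqP => e; move/eqP: hg; rewrite e mul0r eq_sym oner_eq0.
by apply: (mulfI n0); rewrite hg divff.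
Qed.

Lemma c0_modulus_gap f k : c0 f -> f k != 0 ->
  exists2 rho, 0 < rho < cabs (f k) &
    exists2 d, 0 < d & forall g, d <= `|cabs (f g) - rho|.
Proof.
move=> fc0 fk; set lam := cabs (f k).
have lam0 : 0 < lam by rewrite lt_def cabs_eq0 fk cabs_ge0.
have /finite_seqP[s sE] : finite_set [set g | lam / 2 <= cabs (f g)].
  by apply: fc0; rewrite divr_gt0.
(* Only finitely many moduli reach [lam / 2], so those below [lam] are at most some [m < lam]; the
   default [lam / 2] covers the others. Then [rho] is the midpoint of the gap and [d] half its
   length. *)
pose m := \big[Num.max/lam / 2]_(g <- s | cabs (f g) < lam) cabs (f g).
have m1 : m < lam 
  by rewrite /m; elim/big_ind: _ => // [|x y xm ym]; [lra|rewrite gt_max xm].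
have m2 : lam / 2 <= m by exact: bigmax_ge_id.
exists ((m + lam) / 2); first lra.
exists ((lam - m) / 2); first lra.
move=> g; have [glam|glam] := ltP (cabs (f g)) lam; last first.
  by rewrite ger0_norm; lra.
suff : cabs (f g) <= m by move=> gm; rewrite ler0_norm; lra.
have [gs|gs] := leP (cabs (f g)) (lam / 2); first exact: le_trans m2.
apply: (le_bigmax_seq (lam / 2) g (fun g => cabs (f g) < lam) (fun g => cabs (f g))) => //.
have : [set g | lam / 2 <= cabs (f g)] g by exact: ltW.
by rewrite sE.
Qed.

Lemma c0_finite f (r : R) : c0 f -> 0 < r ->
  exists s : seq G, forall g, g \notin s -> cabs (f g) < r.
Proof.
move=> fc0 /fc0 /finite_seqP[s sE]; exists s => g gs; rewrite ltNge; apply/negP => gr.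
have : [set g | r <= cabs (f g)] g by [].
by rewrite sE /= (negPf gs).
Qed.

End NaturalSpectrum.

Section DyadicPower.
Variables (R : realType) (G : groupType).
Local Notation C := R[i].

(** Where [|a| < 1], [eta = 1 - (1 - t)^-1] with [t = a^(2^n)], so [t = - eta (1 - eta)^-1]. The
    right-hand side makes sense on all of G and has norm at most [(1/2) * 2]. *)
Lemma pd_bound_dyadic_power (a : G -> C) n :
  pd_bound (small_indicator a - dyadic_average a n 1) (1 / 2) ->
  exists2 w : G -> C, pd_bound w 1 &
    forall g, cabs (a g) < 1 -> w g = a g ^+ (2 ^ n).
Proof.
set eta := _ - _ => etaB.
exists (- eta * (fun g => (1 - eta g)^-1)).
  have E : (1 - 1 / 2 : R)^-1 = 2 by rewrite (_ : 1 - 1 / 2 = 2^-1) ?invrK//; lra.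
  apply: (@pd_bound_le _ _ _ (1 / 2 * (1 - 1 / 2)^-1)); first by rewrite E; lra.
  apply: pd_boundM; first exact: pd_boundN.
  by apply: pd_bound_neumann => //; lra.
move=> g ag; transitivity (- eta g * (1 - eta g)^-1) => //.
have -> : eta g = 1 - (1 - a g ^+ (2 ^ n))^-1.
  transitivity ((cabs (a g) < 1)%R%:R - (1 - (1 * a g) ^+ (2 ^ n))^-1) => //.
  by rewrite ag mul1r.
have t0 : 1 - a g ^+ (2 ^ n) != 0.
  by apply: cabs_lt1_neq; rewrite cabsX exprn_ilt1 ?cabs_ge0// -lt0n expn_gt0.
by rewrite subKr invrK mulNr mulrBl mulVf// mul1r opprB subKr.
Qed.

End DyadicPower.

Theorem theorem4p22 (R : realType) (G : groupType) (f : G -> R[i])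
    (f_B0 : B0 f) (f_neq0 : f <> 0)
    (f_sing : forall n : nat, (1 <= n)%N -> singular (f ^+ n)) :
  ~ (B0 `&` NS) f.
Proof.
move=> [_ fNS]; have [fB fc0] := f_B0.
have [k fk] : exists k, f k != 0.
  apply: contrapT => H; apply: f_neq0; apply/funext => g.
  by apply/eqP; rewrite -[_ == _]negbK; apply/negP => fg; apply: H; exists g.
have [rho /andP[rho0 rholt] [d d0 gap]] := c0_modulus_gap fc0 fk.
have rhoC : rho%:C%C != 0 :> R[i] by rewrite fmorph_eq0 gt_eqF.
have [s fs] := c0_finite fc0 rho0.
pose a : G -> R[i] := rho%:C%C^-1 *: f.
have aE g : a g = rho%:C%C^-1 * f g by [].
have acabs g : cabs (a g) = cabs (f g) / rho.
  by rewrite aE cabsM cabsV cabs_real ?(ltW rho0)// mulrC.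
have [r0 fr0] := (BG_pd_bound f).1 fB.
have aB : pd_bound a _ := pd_boundZ rho%:C%C^-1 fr0.
have a1 g : cabs (a g) != 1.
  rewrite acabs; apply/eqP => /(canRL (mulfVK (lt0r_neq0 rho0))); rewrite mul1r => E.
  by have := gap g; rewrite E subrr normr0 leNgt d0.
(* [1 - z a = (mu - f) / mu] with [mu = rho / z], and the circle of radius [rho] stays at distance
   [d] from the values of [f]. *)
have resP z : cabs z = 1 -> exists r, pd_bound (resolvent a z) r.
  move=> z1; have z0 : z != 0 by rewrite -cabs_eq0 z1 oner_eq0.
  pose mu := rho%:C%C / z; have mu1 : cabs mu = rho.
    by rewrite cabsM cabsV z1 invr1 mulr1 cabs_real ?(ltW rho0).
  have /(BG_pd_bound _).1[r hr] : BG (fun g => (mu - f g)^-1).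
    apply: (NS_resolvent fNS d0) => g; apply: le_trans (gap g) _.
    rewrite ler_norml; apply/andP; split.
      by rewrite lerNl opprB -{1}mu1 cabsB_ge.
    by rewrite -{1}mu1 -[mu - f g]opprB cabsN cabsB_ge.
  exists (2 * cabs mu * r); have <- : mu *: (fun g => (mu - f g)^-1) = resolvent a z.
    apply/funext => g; transitivity (mu * (mu - f g)^-1) => //; rewrite /resolvent aE.
    have mu0 : mu != 0 by rewrite mulf_neq0 ?invr_neq0.
    rewrite -[mu in LHS]invrK -invfM; congr (_^-1).
    by rewrite /mu; field; rewrite rhoC z0.
  exact: pd_boundZ.
have [B HB] := dyadic_average_approx aB a1 resP.
have [w sw] : exists w, central_support (@delta_e R G) w.
  by have [z [w [_ sw _]]] := f_sing 1%N isT; exists w.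
have [de deE] : exists de : Cstar_dual R G, delta_e R (G := G) = de.
  by have [de E _] := sw; exists de.
(* The point masses [delta_g], as translates of the functional that represents [delta_e] in its
   central support. *)
pose dd g : Cstar_dual R G := dual_shift g^-1%g de.
have ddE g h : dd g h = (h == g)%:R.
  rewrite -[LHS]/(de (g^-1 * h)%g) -deE /delta_e.
  by rewrite -(inj_eq (mulgI g)) mulVKg mulg1.
pose L : Wstar R G := w * Weval R k.
have Ld g : L (dd g) = (g == k)%:R by exact: central_support_delta.
have [M M0 LM] := Wstar_bounded L.
have ak1 : 1 < cabs (a k) by rewrite acabs ltr_pdivlMr// mul1r.
(* [1/2] is the bound required by [pd_bound_dyadic_power], and [M + 2] exceeds the bound [M + 1]
   derived below for [|a k|^(2^n)]; since [2^n >= n], the exponent [n] suffices. *)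
have [n [Bn akn]] : exists n, B * (4 / 5) ^+ n <= 1 / 2 /\ M + 2 <= cabs (a k) ^+ n.
  have c1 : \forall n \near \oo, B * (4 / 5) ^+ n <= 1 / 2.
    have : (fun n : nat => B * (4 / 5) ^+ n : R) @ \oo --> B * 0.
      by apply: cvgMl_tmp; apply: cvg_expr; rewrite ger0_norm; lra.
    by rewrite mulr0 => /cvgr_le; apply; lra.
  have c2 : \forall n \near \oo, ((cabs (a k))^-1) ^+ n <= (M + 2)^-1.
    have : GRing.exp (cabs (a k))^-1 @ \oo --> (0 : R).
      apply: cvg_expr; rewrite ger0_norm ?invr_ge0 ?cabs_ge0// invf_lt1//.
      exact: lt_trans ak1.
    by move=> /cvgr_le; apply; rewrite invr_gt0; lra.
  have [n [Bn H]] := filter_ex (filterI c1 c2); exists n; split=> //.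
  rewrite -lef_pV2 ?posrE ?exprn_gt0 ?(lt_trans ltr01)//; last lra.
  by rewrite -exprVn.
have [v vB vE] := pd_bound_dyadic_power (pd_bound_le Bn (HB n)).
have aNB := pd_bound_exp (2 ^ n) aB.
pose aN : Cstar_dual R G := CstarDual (pd_bound_dual aNB).
pose vD : Cstar_dual R G := CstarDual (pd_bound_dual vB).
have LaN : L aN = 0.
  have fN := f_sing (2 ^ n)%N (expn_gt0 2 n : is_true _).
  have [z [_ [[fD fE _] _ _]]] := fN; rewrite fE in fN.
  have -> : aN = rho%:C%C^-1 ^+ (2 ^ n) *: fD.
    apply/val_inj; rewrite /= -fE; apply/funext => g.
    by rewrite -[RHS]/(_ * _) !exprfctE aE exprMn.
  have LfD : L fD = 0 := singular_vanish _ fN sw.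
  by transitivity (rho%:C%C^-1 ^+ (2 ^ n) * L fD); [exact: linearZ|rewrite LfD mulr0].
(* Outside [s] one has [|a| < 1], so [v] equals [a^(2^n)] there and the difference has finite
   support, where [L] is evaluation at [k]. *)
have LE : L (aN - vD) = a k ^+ (2 ^ n) - v k.
  rewrite (finite_support_eval ddE Ld (s := s)).
    by rewrite -[LHS]/((a ^+ (2 ^ n)) k - v k) exprfctE.
  move=> g gs; rewrite -[LHS]/((a ^+ (2 ^ n)) g - v g) exprfctE vE ?subrr//.
  by rewrite acabs ltr_pdivrMr// mul1r fs.
have Lv : cabs (L vD) <= M.
  apply: le_trans (LM vD) _; rewrite -[leRHS]mulr1 ler_wpM2l//.
  exact: pd_bound_dual_norm.
have vk := pd_bound_cabs k vB.
have : cabs (a k ^+ (2 ^ n)) <= M + 1.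
  have -> : a k ^+ (2 ^ n) = v k - L vD.
    have LB : L (aN - vD) = L aN - L vD by exact: raddfB.
    by rewrite -[a k ^+ _](subrK (v k)) -LE LB LaN sub0r addrC.
  by apply: le_trans (cabsD _ _) _; rewrite cabsN addrC lerD.
rewrite cabsX => akN; have : cabs (a k) ^+ n <= cabs (a k) ^+ (2 ^ n).
  by rewrite ler_weXn2l ?(ltW ak1)// ltnW// ltn_expl.
by move=> /(le_trans akn)/le_trans/(_ akN); rewrite lerD2l (ler_nat R 2 1).
Qed.
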